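(* Let $\mathbb{K}$ be an infinite field, $S=\mathbb{K}[s,t,u]$, and $J=(g_1,g_2,g_3,g_4)\subset S$ an ideal generated by homogeneous polynomials with $\deg(g_1)=\cdots=\deg(g_4)=d$ and $\operatorname{ht}(J)=3$. Then $\beta_1(J)\le 2d+2$ and $\beta_2(J)\le 2d-1$.
   Context: $\beta_i(J)=\dim_{\mathbb{K}}\operatorname{Tor}_i^S(J,\mathbb{K})$. *)

(* Defs.v *)
From HB Require Import structures.
From mathcomp Require Import all_boot all_order all_algebra.
From mathcomp Require Import mpoly.
Set Implicit Arguments. Unset Strict Implicit. Unset Printing Implicit Defensive.
Import Order.TTheory GRing.Theory.
Local Open Scope ring_scope.

Notation S3 K := {mpoly K[3]}.

Definition infinite_type (K : eqType) : Prop := forall s : seq K, exists x : K, x \notin s.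

Definition ideal_gen (K : fieldType) (g : 'I_4 -> S3 K) : S3 K -> Prop :=
  fun p => exists c : 'I_4 -> S3 K, p = \sum_(i < 4) c i * g i.

Definition is_ideal (K : fieldType) (I : S3 K -> Prop) : Prop :=
  I 0 /\ (forall p q, I p -> I q -> I (p + q)) /\ (forall r p, I p -> I (r * p)).

Definition is_prime_ideal (K : fieldType) (P : S3 K -> Prop) : Prop :=
  is_ideal P /\ ~ P 1 /\ (forall p q, P (p * q) -> P p \/ P q).

Definition has_prime_chain (K : fieldType) (P : S3 K -> Prop) (n : nat) : Prop :=
  exists C : nat -> (S3 K -> Prop),
    (forall i, (i <= n)%N -> is_prime_ideal (C i)) /\
    (forall i, (i < n)%N -> (forall p, C i p -> C i.+1 p) /\
                            exists p, C i.+1 p /\ ~ C i p) /\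
    (forall p, C n p <-> P p).

Definition height_ge (K : fieldType) (I : S3 K -> Prop) (n : nat) : Prop :=
  forall P, is_prime_ideal P -> (forall p, I p -> P p) -> has_prime_chain P n.

Definition height_eq (K : fieldType) (I : S3 K -> Prop) (n : nat) : Prop :=
  height_ge I n /\ ~ height_ge I n.+1.

Definition in_max (K : fieldType) (p : S3 K) : Prop := p@_(0%MM) = 0.

(* A minimal graded free resolution of the ideal J (viewed as an S-module),
   truncated after homological degree 2:
        F_2 --phi2--> F_1 --phi1--> F_0 --phi0--> J --> 0
   with F_i = S^{b_i} (row vectors, maps act on the right), the basis element k
   of F_i having degree a_i k, all maps homogeneous of degree 0, exact at J,
   F_0 and F_1, and minimal: ker(phi_i) is contained in m F_i for i = 0,1,2
   (equivalently the images of the bases are minimal homogeneous generating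
   systems of J, ker phi0, ker phi1). *)
Definition min_graded_res_2 (K : fieldType) (J : S3 K -> Prop)
    (b0 b1 b2 : nat) : Prop :=
  exists (a0 : 'I_b0 -> nat) (a1 : 'I_b1 -> nat) (a2 : 'I_b2 -> nat)
         (phi0 : 'M[S3 K]_(b0, 1)) (phi1 : 'M[S3 K]_(b1, b0))
         (phi2 : 'M[S3 K]_(b2, b1)),
    (forall l, phi0 l 0 \is (a0 l).-homog) /\
    (forall k l, phi1 k l = 0 \/ ((a0 l <= a1 k)%N /\ phi1 k l \is (a1 k - a0 l)%N.-homog)) /\
    (forall k l, phi2 k l = 0 \/ ((a1 l <= a2 k)%N /\ phi2 k l \is (a2 k - a1 l)%N.-homog)) /\
    (forall p, J p <-> exists v : 'rV[S3 K]_b0, p = (v *m phi0) 0 0) /\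
    (forall v : 'rV[S3 K]_b0, v *m phi0 = 0 <-> exists w : 'rV[S3 K]_b1, v = w *m phi1) /\
    (forall v : 'rV[S3 K]_b1, v *m phi1 = 0 <-> exists w : 'rV[S3 K]_b2, v = w *m phi2) /\
    (forall v : 'rV[S3 K]_b0, v *m phi0 = 0 -> forall l, in_max (v 0 l)) /\
    (forall v : 'rV[S3 K]_b1, v *m phi1 = 0 -> forall l, in_max (v 0 l)) /\
    (forall v : 'rV[S3 K]_b2, v *m phi2 = 0 -> forall l, in_max (v 0 l)).

(* beta_i(J) = n  (i = 0,1,2): n is the rank of F_i in a minimal graded free
   resolution of J; this is dim_K Tor_i^S(J,K). *)
Definition betti_eq (K : fieldType) (J : S3 K -> Prop) (i n : nat) : Prop :=
  exists b0 b1 b2, min_graded_res_2 J b0 b1 b2 /\ nth 0%N [:: b0; b1; b2] i = n.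

(* Main.v *)
Require Import Defs.
From HB Require Import structures.
From mathcomp Require Import all_boot all_order all_algebra.
From mathcomp Require Import mpoly.
From mathcomp Require Import ring zify.
From mathcomp Require boolp classical_sets.
Local Open Scope ring_scope.
Set Implicit Arguments. Unset Strict Implicit. Unset Printing Implicit Defensive.
Import GRing.Theory.

(** Let [S] be the polynomial ring and [J] the ideal of the four forms. The
    height hypothesis puts a power of each variable in [J]. The four forms
    satisfy a homogeneous equation, so after a general linear change of
    generators one of them, [g0], is nilpotent modulo the ideal [G] of the three
    others; then [S / G] is finite dimensional, the Koszul complex of the three
    forms is exact, and comparing it with the Koszul complex of the variables
    shows that the socle of [S / G] has dimension at most one.

    Counting dimensions in degree [2 d - 1] gives a nonzero form [C] of degree
    [d - 1] with [C g0] in [G]. Choose linear coordinates [x, y, z] such that [C]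
    is a nonzero multiple of [x ^ (d - 1)] modulo [y, z]. With [B = g0 S / G],
    this bounds by [d - 1] the dimensions of [B / (y, z) B] and of the
    annihilator of [y, z] in [B]. If [a] is in the socle of [S / J], then
    [(y a, z a)] is a pair in [B], and counting ranks shows that the socle of
    [S / J] has dimension at most [(d - 1) + (d - 1) + 1 = 2 d - 1].

    The Betti number [b2] is at most this socle dimension, and [b1] is at most
    the dimension of the second Koszul homology of [S / J], which exceeds the
    socle dimension by at most [4 - 1] because the Euler characteristic of the
    Koszul complex vanishes. *)

(** * Comparing a free complex with the Koszul complex *)

(* Exactness in degree one of the Koszul complexes of [x], [(x, y)] and
   [(x, y, z)], elementwise; it holds for every regular sequence. *)
Definition koszul_exact (R : comNzRingType) (x y z : R) : Prop :=
  [/\ forall f, x * f = 0 -> f = 0,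
      forall f h, x * f = y * h -> exists2 w, f = y * w & h = x * w
    & forall f g h, x * f + y * g + z * h = 0 ->
        exists a b c, [/\ f = y * c - z * b, g = z * a - x * c & h = x * b - y * a]].

Section KoszulVectors.
Variables (R : comNzRingType) (x y z : R).
Hypothesis xyz : koszul_exact x y z.

Lemma koszul_scaler_inj n (u v : 'rV[R]_n) : x *: u = x *: v -> u = v.
Proof.
have [x_reg _ _] := xyz; move=> /rowP e; apply/rowP => j.
apply/eqP; rewrite -subr_eq0; apply/eqP/x_reg.
by move: (e j); rewrite !mxE mulrBr => ->; rewrite subrr.
Qed.

Lemma koszul_exact_row2 n (u v : 'rV[R]_n) :
  x *: u = y *: v -> exists2 w, u = y *: w & v = x *: w.
Proof.
have [_ xy_reg _] := xyz; move=> /rowP e.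
have /fin_all_exists2[w uw vw] j : exists2 w, u 0 j = y * w & v 0 j = x * w.
  by apply: xy_reg; move: (e j); rewrite !mxE.
by exists (\row_j w j); apply/rowP => j; rewrite !mxE.
Qed.

Lemma koszul_exact_row3 n (u v w : 'rV[R]_n) :
  x *: u + y *: v + z *: w = 0 ->
  exists a b c, [/\ u = y *: c - z *: b, v = z *: a - x *: c & w = x *: b - y *: a].
Proof.
have [_ _ xyz_reg] := xyz; move=> /rowP e.
have /fin_all_exists[a /fin_all_exists[b /fin_all_exists[c abc]]] j :
    exists a b c, [/\ u 0 j = y * c - z * b, v 0 j = z * a - x * c & w 0 j = x * b - y * a].
  by apply: xyz_reg; move: (e j); rewrite !mxE.
by exists (\row_j a j), (\row_j b j), (\row_j c j); split; apply/rowP => j;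
  rewrite !mxE; case: (abc j).
Qed.

End KoszulVectors.

(* One step of the zigzag comparing a free complex with the Koszul complex:
   [l] lives on the free module mapped by [phi2], [q] is a Koszul 2-chain with
   values in the target of [phi1]. *)
Definition koszul_lift (R : comNzRingType) (x y z : R) (n0 n1 n2 : nat)
    (phi1 : 'M[R]_(n1, n0)) (phi2 : 'M[R]_(n2, n1))
    (q1 q2 q3 : 'rV[R]_n0) (l : 'rV[R]_n2) : Prop :=
  exists a1 a2 a3, [/\ l *m phi2 = x *: a1 + y *: a2 + z *: a3,
    a1 *m phi1 = y *: q3 - z *: q2, a2 *m phi1 = z *: q1 - x *: q3
  & a3 *m phi1 = x *: q2 - y *: q1].

(* The full zigzag: it relates socle elements [u] of coker [phi1] with
   elements [l] of the free module in homological degree 3. *)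
Definition koszul_rel (R : comNzRingType) (x y z : R) (n0 n1 n2 n3 : nat)
    (phi1 : 'M[R]_(n1, n0)) (phi2 : 'M[R]_(n2, n1)) (phi3 : 'M[R]_(n3, n2))
    (u : 'rV[R]_n0) (l : 'rV[R]_n3) : Prop :=
  exists p1 p2 p3, [/\ koszul_lift x y z phi2 phi3 p1 p2 p3 l,
    p1 *m phi1 = x *: u, p2 *m phi1 = y *: u & p3 *m phi1 = z *: u].

Definition ideal3 (R : comNzRingType) (x y z : R) (p : R) : Prop :=
  exists a b c, p = x * a + y * b + z * c.

Section Zigzag.
Variables (R : comNzRingType) (x y z : R).
Hypothesis xyz : koszul_exact x y z.

Section Lift.
Variables (n0 n1 n2 : nat) (phi1 : 'M[R]_(n1, n0)) (phi2 : 'M[R]_(n2, n1)).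
Hypothesis phi21 : phi2 *m phi1 = 0.

Lemma koszul_lift_lin (c : R) q1 q2 q3 l q1' q2' q3' l' :
  koszul_lift x y z phi1 phi2 q1 q2 q3 l ->
  koszul_lift x y z phi1 phi2 q1' q2' q3' l' ->
  koszul_lift x y z phi1 phi2 (c *: q1 + q1') (c *: q2 + q2') (c *: q3 + q3') (c *: l + l').
Proof.
move=> [a1 [a2 [a3 [e0 e1 e2 e3]]]] [b1 [b2 [b3 [f0 f1 f2 f3]]]].
exists (c *: a1 + b1), (c *: a2 + b2), (c *: a3 + b3).
split; rewrite mulmxDl -scalemxAl ?e0 ?e1 ?e2 ?e3 ?f0 ?f1 ?f2 ?f3;
  by apply/rowP => j; rewrite !mxE; ring.
Qed.

(** As [phi2 *m phi1 = 0], the images of the [a_i] under [phi1] form a Koszul cycle, which exactness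
    turns into a boundary. *)
Lemma koszul_lift_total (l : 'rV[R]_n2) (a1 a2 a3 : 'rV[R]_n1) :
  l *m phi2 = x *: a1 + y *: a2 + z *: a3 ->
  exists q1 q2 q3, koszul_lift x y z phi1 phi2 q1 q2 q3 l.
Proof.
move=> e.
have : x *: (a1 *m phi1) + y *: (a2 *m phi1) + z *: (a3 *m phi1) = 0.
  by rewrite !scalemxAl -!mulmxDl -e -mulmxA phi21 mulmx0.
by case/(koszul_exact_row3 xyz) => q1 [q2 [q3 [? ? ?]]]; exists q1, q2, q3, a1, a2, a3.
Qed.

(** If [q] is a Koszul boundary modulo the image of [phi1], the [r_i] correct each [a_i] to a vector
    in the kernel of [phi1], hence in the image of [phi2]; the corrections cancel in the sum. *)
Lemma koszul_lift_boundary q1 q2 q3 (l : 'rV[R]_n2) (u : 'rV[R]_n0) (r1 r2 r3 : 'rV[R]_n1) :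
  (forall v : 'rV_n1, v *m phi1 = 0 -> exists w : 'rV_n2, v = w *m phi2) ->
  koszul_lift x y z phi1 phi2 q1 q2 q3 l ->
  q1 = x *: u + r1 *m phi1 -> q2 = y *: u + r2 *m phi1 -> q3 = z *: u + r3 *m phi1 ->
  exists b1 b2 b3, (l - (x *: b1 + y *: b2 + z *: b3)) *m phi2 = 0.
Proof.
move=> ex [a1 [a2 [a3 [e0 e1 e2 e3]]]] f1 f2 f3.
have [b1 h1] : exists w : 'rV_n2, a1 - (y *: r3 - z *: r2) = w *m phi2.
  apply: ex; rewrite !mulmxBl -!scalemxAl e1 f2 f3.
  by move: (r3 *m _) (r2 *m _) => s3 s2; apply/rowP => j; rewrite !mxE; ring.
have [b2 h2] : exists w : 'rV_n2, a2 - (z *: r1 - x *: r3) = w *m phi2.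
  apply: ex; rewrite !mulmxBl -!scalemxAl e2 f1 f3.
  by move: (r3 *m _) (r1 *m _) => s3 s2; apply/rowP => j; rewrite !mxE; ring.
have [b3 h3] : exists w : 'rV_n2, a3 - (x *: r2 - y *: r1) = w *m phi2.
  apply: ex; rewrite !mulmxBl -!scalemxAl e3 f1 f2.
  by move: (r1 *m _) (r2 *m _) => s3 s2; apply/rowP => j; rewrite !mxE; ring.
exists b1, b2, b3; rewrite mulmxBl !mulmxDl -!scalemxAl e0 -h1 -h2 -h3.
by apply/rowP => j; rewrite !mxE; ring.
Qed.

End Lift.

Section Rel.
Variables (n0 n1 n2 n3 : nat).
Variables (phi1 : 'M[R]_(n1, n0)) (phi2 : 'M[R]_(n2, n1)) (phi3 : 'M[R]_(n3, n2)).
Hypothesis ker1 : forall v : 'rV_n1, v *m phi1 = 0 <-> exists w : 'rV_n2, v = w *m phi2.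
Hypothesis ker2 : forall v : 'rV_n2, v *m phi2 = 0 <-> exists w : 'rV_n3, v = w *m phi3.

Let rel := koszul_rel x y z phi1 phi2 phi3.

Lemma koszul_rel_lin (c : R) u l u' l' :
  rel u l -> rel u' l' -> rel (c *: u + u') (c *: l + l').
Proof.
move=> [p1 [p2 [p3 [h e1 e2 e3]]]] [q1 [q2 [q3 [k f1 f2 f3]]]].
exists (c *: p1 + q1), (c *: p2 + q2), (c *: p3 + q3).
split; first exact: koszul_lift_lin.
all: rewrite mulmxDl -scalemxAl ?e1 ?e2 ?e3 ?f1 ?f2 ?f3.
all: by apply/rowP => j; rewrite !mxE; ring.
Qed.

(** The downward chase, by exactness of the free complex: the crossed differences of the [p_i] lie
    in the kernel of [phi1], and the combination of their lifts lies in the kernel of [phi2]. *)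
Lemma koszul_rel_of_socle (u : 'rV[R]_n0) :
  (exists p : 'rV_n1, p *m phi1 = x *: u) -> (exists p : 'rV_n1, p *m phi1 = y *: u) ->
  (exists p : 'rV_n1, p *m phi1 = z *: u) -> exists l, rel u l.
Proof.
move=> [p1 e1] [p2 e2] [p3 e3].
have [a1 f1] : exists w : 'rV_n2, y *: p3 - z *: p2 = w *m phi2.
  by apply/ker1; rewrite mulmxBl -!scalemxAl e2 e3; apply/rowP => j; rewrite !mxE; ring.
have [a2 f2] : exists w : 'rV_n2, z *: p1 - x *: p3 = w *m phi2.
  by apply/ker1; rewrite mulmxBl -!scalemxAl e1 e3; apply/rowP => j; rewrite !mxE; ring.
have [a3 f3] : exists w : 'rV_n2, x *: p2 - y *: p1 = w *m phi2.
  by apply/ker1; rewrite mulmxBl -!scalemxAl e1 e2; apply/rowP => j; rewrite !mxE; ring.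
have [l el] : exists w : 'rV_n3, x *: a1 + y *: a2 + z *: a3 = w *m phi3.
  apply/ker2; rewrite !mulmxDl -!scalemxAl -f1 -f2 -f3.
  by apply/rowP => j; rewrite !mxE; ring.
by exists l, p1, p2, p3; split=> //; exists a1, a2, a3; split.
Qed.

(** The upward chase, by exactness of the Koszul complexes: it produces the [p_i], then [u] from two
    of them; the last equation follows by cancelling [x]. *)
Lemma koszul_rel_of_bottom (l : 'rV[R]_n3) (a1 a2 a3 : 'rV[R]_n2) :
  l *m phi3 = x *: a1 + y *: a2 + z *: a3 -> exists u, rel u l.
Proof.
have phi32 : phi3 *m phi2 = 0.
  by apply/row_matrixP => i; rewrite row_mul row0; apply/ker2; exists (delta_mx 0 i); rewrite rowE.
have phi21 : phi2 *m phi1 = 0.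
  by apply/row_matrixP => i; rewrite row_mul row0; apply/ker1; exists (delta_mx 0 i); rewrite rowE.
case/(koszul_lift_total phi32) => p1 [p2 [p3 [b1 [b2 [b3 [e e1 e2 e3]]]]]].
have z0 (b : 'rV_n2) : b *m phi2 *m phi1 = 0 by rewrite -mulmxA phi21 mulmx0.
have : x *: (p2 *m phi1) = y *: (p1 *m phi1).
  by apply/eqP; rewrite -subr_eq0 !scalemxAl -mulmxBl -e3 z0.
case/(koszul_exact_row2 xyz) => u h2 h1.
exists u, p1, p2, p3; split=> //; first by exists b1, b2, b3.
apply: (koszul_scaler_inj xyz); apply/esym/eqP; rewrite -subr_eq0.
rewrite scalerA mulrC -scalerA -h1 !scalemxAl -mulmxBl -e2 z0; exact/eqP.
Qed.

(** This and [koszul_rel_socle] say that the zigzag respects zero classes in both directions. Here a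
    preimage [w] of [u] makes the [p_i] a Koszul boundary modulo the image of [phi2]. *)
Lemma koszul_rel_bottom u l : rel u l -> (exists w : 'rV_n1, u = w *m phi1) ->
  exists b1 b2 b3, (l - (x *: b1 + y *: b2 + z *: b3)) *m phi3 = 0.
Proof.
move=> [p1 [p2 [p3 [h e1 e2 e3]]]] [w uw].
have st t p : p *m phi1 = t *: u -> exists r : 'rV_n2, p = t *: w + r *m phi2.
  move=> e; have [r er] : exists r : 'rV_n2, p - t *: w = r *m phi2.
    by apply/ker1; rewrite mulmxBl e uw -scalemxAl subrr.
  by exists r; rewrite -er addrC subrK.
have [r1 f1] := st _ _ e1; have [r2 f2] := st _ _ e2; have [r3 f3] := st _ _ e3.
by apply: (koszul_lift_boundary _ h f1 f2 f3) => v /ker2.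
Qed.

(** Subtracting the images of the [b_i] from the [a_i] leaves a Koszul cycle, so a boundary of some
    [c_i]; correcting the [p_i] by the images of the [c_i] leaves a multiple [(x w, y w, z w)], and
    [w] maps to [u]. *)
Lemma koszul_rel_socle u l (b1 b2 b3 : 'rV[R]_n3) :
  (forall v : 'rV_n3, v *m phi3 = 0 -> v = 0) ->
  rel u l -> l = x *: b1 + y *: b2 + z *: b3 -> exists w : 'rV_n1, u = w *m phi1.
Proof.
move=> inj3 [p1 [p2 [p3 [[a1 [a2 [a3 [e f1 f2 f3]]]] e1 e2 e3]]]] el.
have : x *: (a1 - b1 *m phi3) + y *: (a2 - b2 *m phi3) + z *: (a3 - b3 *m phi3) = 0.
  rewrite !scalerBr; apply/eqP; rewrite -(subrr (l *m phi3)) {1}e el !mulmxDl -!scalemxAl.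
  by apply/eqP/rowP => j; rewrite !mxE; ring.
case/(koszul_exact_row3 xyz) => c1 [c2 [c3 [g1 g2 g3]]].
have phi32 (b : 'rV_n3) : b *m phi3 *m phi2 = 0 by apply/ker2; exists b.
have phi21 (b : 'rV_n2) : b *m phi2 *m phi1 = 0 by apply/ker1; exists b.
have : x *: (p2 - c2 *m phi2) = y *: (p1 - c1 *m phi2).
  have := congr1 (mulmx^~ phi2) g3.
  rewrite !mulmxBl phi32 subr0 f3 -!scalemxAl => /eqP; rewrite -subr_eq0 => /eqP h.
  apply/eqP; rewrite -subr_eq0 -h.
  by apply/eqP/rowP => j; rewrite !mxE; ring.
case/(koszul_exact_row2 xyz) => w h2 h1.
exists w; apply: (koszul_scaler_inj xyz).
by rewrite -e1 scalemxAl -h1 mulmxBl phi21 subr0.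
Qed.

End Rel.
End Zigzag.

(** * Polynomials in three variables *)

Section Divide.
Variables (n : nat) (K : fieldType).
Implicit Types (f g : {mpoly K[n]}) (i j : 'I_n) (m : 'X_{1..n}).

(* The quotient of [f] by ['X_i ^+ N], discarding the terms of degree less
   than [N] in ['X_i]. *)
Definition mdivX i N f : {mpoly K[n]} :=
  \sum_(m <- msupp f | (N <= m i)%N) f@_m *: 'X_[m - U_(i) *+ N].

Lemma mcoeff_mdivX i N f m : (mdivX i N f)@_m = f@_(m + U_(i) *+ N).
Proof.
have le_U (k : 'X_{1..n}) : (N <= k i)%N -> (U_(i) *+ N <= k)%MM.
  move=> Nk; apply/mnm_lepP => j; rewrite mulmnE mnm1E.
  by case: (i =P j) => [<-|_]; rewrite ?mul1n.
have U_ge : (N <= (m + U_(i) *+ N)%MM i)%N.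
  by rewrite mnmDE mulmnE mnm1E eqxx mul1n leq_addl.
rewrite /mdivX raddf_sum /=.
have eqU (k : 'X_{1..n}) : (N <= k i)%N -> ((k - U_(i) *+ N)%MM == m) = (k == m + U_(i) *+ N)%MM.
  by move=> /le_U/submK Nk; rewrite -[in RHS]Nk eqm_add2r.
under eq_bigr => k Nk do rewrite mcoeffZ mcoeffX eqU //.
have [|/memN_msupp_eq0 e] := boolP ((m + U_(i) *+ N)%MM \in msupp f).
  move=> min; rewrite big_mkcond (bigD1_seq (m + U_(i) *+ N)%MM) ?msupp_uniq //=.
  rewrite U_ge eqxx mulr1 big1 ?addr0 // => k /negPf ->.
  by rewrite mulr0 if_same.
rewrite e big1_seq // => k /andP[_ _].
by case: eqP => [->|_]; rewrite ?e ?mul0r ?mulr0.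
Qed.

Lemma mcoeffMXn f k m :
  (f * 'X_[k])@_m = if (k <= m)%MM then f@_(m - k) else 0.
Proof.
case: ifPn => [km|nkm]; first by rewrite -{1}(submK km) addmC mcoeffMX.
apply: memN_msupp_eq0; rewrite (perm_mem (msuppMX _ _)).
by apply: contra nkm => /mapP[m' _ ->]; apply: lem_addr.
Qed.

Lemma mdivX_is_additive i N : additive (mdivX i N).
Proof. by move=> f g; apply/mpolyP => m; rewrite mcoeffB !mcoeff_mdivX mcoeffB. Qed.
HB.instance Definition _ i N :=
  GRing.isAdditive.Build {mpoly K[n]} {mpoly K[n]} (mdivX i N) (mdivX_is_additive i N).

Lemma mdivXK i N f : mdivX i N ('X_i ^+ N * f) = f.
Proof. by apply/mpolyP => m; rewrite mcoeff_mdivX mpolyXn mulrC addmC mcoeffMX. Qed.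

Lemma mdivX_comm i j N M f : i != j -> mdivX i N ('X_j ^+ M * f) = 'X_j ^+ M * mdivX i N f.
Proof.
move=> ij; apply/mpolyP => m; rewrite mcoeff_mdivX mpolyXn mulrC mcoeffMXn.
rewrite [RHS](_ : _ = (mdivX i N f * 'X_[U_(j) *+ M])@_m); last by rewrite mulrC.
rewrite mcoeffMXn mcoeff_mdivX.
have -> : (U_(j) *+ M <= m + U_(i) *+ N)%MM = (U_(j) *+ M <= m)%MM.
  apply/mnm_lepP/mnm_lepP => le k; move: (le k); rewrite mnmDE !mulmnE !mnm1E.
    by case: (j =P k) => [<-|_]; rewrite ?(negPf ij) ?mul0n ?addn0.
  by move=> /leq_trans; apply; apply: leq_addr.
case: ifP => // /mnm_lepP le; congr (f@_ _); apply/mnmP => k.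
move: (le k); rewrite !mnmDE !mnmBE !mnmDE !mulmnE !mnm1E.
by case: (j =P k) => [<-|_]; rewrite ?(negPf ij); lia.
Qed.

End Divide.

Section Vars.
Variable K : fieldType.
Implicit Types (f g h : {mpoly K[3]}) (N : nat).


Notation X0 := ('X_(0 : 'I_3) : {mpoly K[3]}).
Notation X1 := ('X_(1 : 'I_3) : {mpoly K[3]}).
Notation X2 := ('X_(2%:R : 'I_3) : {mpoly K[3]}).

Lemma koszul_exact_vars N : koszul_exact (X0 ^+ N) (X1 ^+ N) (X2 ^+ N).
Proof.
have inj i f : 'X_i ^+ N * f = 0 -> f = 0.
  by move=> e; rewrite -(mdivXK i N f) e raddf0.
have two f h : X0 ^+ N * f = X1 ^+ N * h -> exists2 w, f = X1 ^+ N * w & h = X0 ^+ N * w.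
  move=> e; have fE : f = X1 ^+ N * mdivX 0 N h by rewrite -mdivX_comm // -e mdivXK.
  exists (mdivX 0 N h) => //; apply/eqP; rewrite -subr_eq0; apply/eqP/(inj 1).
  by rewrite mulrBr -e {1}fE; ring.
split=> [||f g h e]; [exact: inj | exact: two |].
(* [A] and [r] are the quotient and remainder of [h] by [X0 ^+ N]. Subtracting from the relation
   [X0 ^+ N] times its own quotient removes [f]. *)
pose A := mdivX 0 N h; pose r := h - X0 ^+ N * A.
have e1 : X1 ^+ N * (g - X0 ^+ N * mdivX 0 N g) + X2 ^+ N * r = 0.
  have := congr1 (mdivX 0 N) e; rewrite !raddfD raddf0 /= mdivXK !mdivX_comm // => e'.
  rewrite (_ : _ + _ = X0 ^+ N * f + X1 ^+ N * g + X2 ^+ N * h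
     - X0 ^+ N * (f + X1 ^+ N * mdivX 0 N g + X2 ^+ N * mdivX 0 N h)).
    by rewrite e e' mulr0 subr0.
  by rewrite /r /A; ring.
pose B := mdivX 1 N r.
have rE : r = X1 ^+ N * B.
  have := congr1 (mdivX 1 N) e1; rewrite raddfD raddf0 /= mdivXK mdivX_comm // => e'.
  apply/eqP; rewrite -subr_eq0; apply/eqP/(inj 2%:R).
  rewrite (_ : _ * _ = X1 ^+ N * (g - X0 ^+ N * mdivX 0 N g) + X2 ^+ N * r
     - X1 ^+ N * (g - X0 ^+ N * mdivX 0 N g + X2 ^+ N * B)).
    by rewrite e1 e' mulr0 subr0.
  by ring.
have hE : h = X0 ^+ N * A + X1 ^+ N * B by rewrite -rE /r addrC subrK.
(* Once [h] is expressed through the first two powers, the relation involves only those two. *)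
have : X0 ^+ N * (f + X2 ^+ N * A) = X1 ^+ N * (- (g + X2 ^+ N * B)).
  by apply/eqP; rewrite -subr_eq0 -e hE; apply/eqP; ring.
case/two => w fE gE.
exists (- B), A, w; split.
- by rewrite -fE; ring.
- by rewrite -gE; ring.
- by rewrite hE; ring.
Qed.

Lemma in_maxP f : in_max f <-> ideal3 X0 X1 X2 f.
Proof.
have divE i g : g = 'X_i * mdivX i 1 g + (g - 'X_i * mdivX i 1 g) by rewrite addrC subrK.
have coefX i g m : ('X_i * g)@_m = if (m i != 0%N) then g@_(m - U_(i)) else 0.
  by rewrite mulrC mcoeffMXn lep1mP.
have remE i g m : (g - 'X_i * mdivX i 1 g)@_m = if m i == 0%N then g@_m else 0.
  rewrite mcoeffB coefX mcoeff_mdivX mulm1n; case: eqP => [_|/eqP mi] /=; first by rewrite subr0.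
  by rewrite submK ?lep1mP // subrr.
split=> [f0|[a [b [c ->]]]]; last first.
  by rewrite /in_max !mcoeffD !coefX !mnm0E /= !addr0.
(* Each step removes the terms divisible by one more variable, so [f3] is the constant term of
   [f]. *)
pose f1 := f - X0 * mdivX 0 1 f; pose f2 := f1 - X1 * mdivX 1 1 f1.
pose f3 := f2 - X2 * mdivX 2%:R 1 f2.
have f30 : f3 = 0.
  apply/mpolyP => m; rewrite mcoeff0 !remE.
  case: eqP => // m2; case: eqP => // m1; case: eqP => // m0.
  rewrite -[RHS]f0; congr (f@_ _); apply/mnmP => i; rewrite mnm0E.
  case: i => [[|[|[|//]]] ilt].
  - by rewrite (_ : Ordinal ilt = 0) //; apply: val_inj.
  - by rewrite (_ : Ordinal ilt = 1) //; apply: val_inj.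
  - by rewrite (_ : Ordinal ilt = 2%:R) //; apply: val_inj.
exists (mdivX 0 1 f), (mdivX 1 1 f1), (mdivX 2%:R 1 f2).
by rewrite {1}(divE 0 f) -/f1 {1}(divE 1 f1) -/f2 {1}(divE 2%:R f2) -/f3 f30; ring.
Qed.

Lemma mpoly_split_const f : in_max (f - (f@_0%MM)%:MP).
Proof. by rewrite /in_max mcoeffB mcoeffC eqxx mulr1 subrr. Qed.

End Vars.

(** * The Koszul complex of three elements *)

Section KoszulTriple.
Variable R : comNzRingType.
Implicit Types h v p : 'rV[R]_3.

(* [v *m cross_mx h] is the cross product of [v] and [h]. *)
Definition cross_mx h : 'M[R]_3 :=
  \matrix_(i, j) match nat_of_ord i, nat_of_ord j with
    | 1%N, 0%N => h 0 2%:R | 2%N, 0%N => - h 0 1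
    | 2%N, 1%N => h 0 0 | 0%N, 1%N => - h 0 2%:R
    | 0%N, 2%N => h 0 1 | 1%N, 2%N => - h 0 0
    | _, _ => 0 end.

Lemma big_ord3 (F : 'I_3 -> R) : \sum_i F i = F 0 + F 1 + F 2%:R.
Proof.
rewrite !big_ord_recl big_ord0 addr0 addrA; congr (F _ + F _ + F _); exact: val_inj.
Qed.

Lemma mul_cross_mx h v :
  [/\ (v *m cross_mx h) 0 0 = v 0 1 * h 0 2%:R - v 0 2%:R * h 0 1,
     (v *m cross_mx h) 0 1 = v 0 2%:R * h 0 0 - v 0 0 * h 0 2%:R
   & (v *m cross_mx h) 0 2%:R = v 0 0 * h 0 1 - v 0 1 * h 0 0].
Proof.
have n0 : nat_of_ord (0 : 'I_3) = 0%N by [].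
have n1 : nat_of_ord (1 : 'I_3) = 1%N by [].
have n2 : nat_of_ord (2%:R : 'I_3) = 2%N by [].
by split; rewrite mxE big_ord3 !mxE n0 ?n1 ?n2; ring.
Qed.

Lemma row3P v p : v 0 0 = p 0 0 -> v 0 1 = p 0 1 -> v 0 2%:R = p 0 2%:R -> v = p.
Proof.
move=> e0 e1 e2; apply/rowP => -[[|[|[|//]]] ilt].
- by rewrite (_ : Ordinal ilt = 0) //; apply: val_inj.
- by rewrite (_ : Ordinal ilt = 1) //; apply: val_inj.
- by rewrite (_ : Ordinal ilt = 2%:R) //; apply: val_inj.
Qed.

Lemma mul_row_tr v h : (v *m h^T) 0 0 = v 0 0 * h 0 0 + v 0 1 * h 0 1 + v 0 2%:R * h 0 2%:R.
Proof. by rewrite mxE big_ord3 !mxE. Qed.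

Lemma mul_rV1 n (w : 'rV[R]_1) (v : 'rV[R]_n) : w *m v = w 0 0 *: v.
Proof. by apply/rowP => j; rewrite !mxE big_ord1. Qed.

Lemma cross_mx_dot h v : v *m cross_mx h *m h^T = 0.
Proof.
have [e0 e1 e2] := mul_cross_mx h v.
by apply/rowP => j; rewrite !ord1 mul_row_tr e0 e1 e2 mxE; ring.
Qed.

Lemma cross_mx_self h (w : 'rV[R]_1) : w *m h *m cross_mx h = 0.
Proof.
rewrite mul_rV1; have [e0 e1 e2] := mul_cross_mx h (w 0 0 *: h).
by apply: row3P; rewrite ?e0 ?e1 ?e2 !mxE; ring.
Qed.

Variables (t1 t2 t3 : R) (h : 'rV[R]_3).
Hypothesis t123 : koszul_exact t1 t2 t3.
Hypothesis t1h : exists c : 'rV_3, t1%:M = c *m h^T.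
Hypothesis t2h : exists c : 'rV_3, t2%:M = c *m h^T.
Hypothesis t3h : exists c : 'rV_3, t3%:M = c *m h^T.

Lemma koszul_triple0 (w : 'rV[R]_1) : w *m h = 0 -> w = 0.
Proof.
move=> wh0; have [c tc] := t1h; apply: (koszul_scaler_inj t123).
rewrite scaler0 -mul_scalar_mx tc -mulmxA.
rewrite (_ : w = w^T); last by apply/matrixP => i j; rewrite mxE !ord1.
by rewrite -trmx_mul wh0 trmx0 mulmx0.
Qed.

(** Contraction with [c] is a homotopy: the witness is the dot product of [v] and [c], and the
    vanishing cross product allows the exchanges [v_i h_j = v_j h_i]. *)
Lemma koszul_triple_kill1 t v : (exists c : 'rV_3, t%:M = c *m h^T) ->
  v *m cross_mx h = 0 -> exists w : 'rV_1, w *m h = t *: v.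
Proof.
move=> [c /matrixP/(_ 0 0)]; rewrite mul_row_tr mxE eqxx mulr1n => -> /rowP v0.
have [] := mul_cross_mx h v; rewrite !v0 !mxE => /esym/eqP.
rewrite subr_eq0 => /eqP e0 /esym/eqP; rewrite subr_eq0 => /eqP e1.
move=> /esym/eqP; rewrite subr_eq0 => /eqP e2.
exists (v *m c^T); rewrite mul_rV1 mul_row_tr.
apply: row3P; rewrite !mxE.
- rewrite [LHS](_ : _ = v 0 0 * c 0 0 * h 0 0 + c 0 1 * (v 0 1 * h 0 0)
      + c 0 2%:R * (v 0 2%:R * h 0 0)).
    by rewrite -e2 e1; ring.
  by ring.
- rewrite [LHS](_ : _ = c 0 0 * (v 0 0 * h 0 1) + c 0 1 * v 0 1 * h 0 1
      + c 0 2%:R * (v 0 2%:R * h 0 1)).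
    by rewrite e2 -e0; ring.
  by ring.
- rewrite [LHS](_ : _ = c 0 0 * (v 0 0 * h 0 2%:R) + c 0 1 * (v 0 1 * h 0 2%:R)
      + c 0 2%:R * v 0 2%:R * h 0 2%:R).
    by rewrite -e1 e0; ring.
  by ring.
Qed.

(** The witness is the cross product of [c] and [p]: crossed with [h] it gives
    [(c . h) p - (p . h) c], where [p . h = 0]. *)
Lemma koszul_triple_kill2 t p : (exists c : 'rV_3, t%:M = c *m h^T) ->
  p *m h^T = 0 -> exists w : 'rV_3, w *m cross_mx h = t *: p.
Proof.
move=> [c /matrixP/(_ 0 0)]; rewrite mul_row_tr mxE eqxx mulr1n => -> /rowP/(_ 0).
rewrite mul_row_tr mxE => ph.
exists (c *m cross_mx p).
have [e0 e1 e2] := mul_cross_mx h (c *m cross_mx p).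
have [f0 f1 f2] := mul_cross_mx p c.
have sub0 (a b d : R) : a = b - d * (p 0 0 * h 0 0 + p 0 1 * h 0 1 + p 0 2%:R * h 0 2%:R) -> a = b.
  by rewrite ph mulr0 subr0.
apply: row3P; rewrite ?e0 ?e1 ?e2 ?f0 ?f1 ?f2 !mxE.
- by apply: (sub0 _ _ (c 0 0)); ring.
- by apply: (sub0 _ _ (c 0 1)); ring.
- by apply: (sub0 _ _ (c 0 2%:R)); ring.
Qed.

(* The homology of the Koszul complex of [h] is killed by the ideal of [h],
   hence by [t1, t2, t3]; the zigzag then shows that it vanishes. *)
Lemma koszul_triple1 v : v *m cross_mx h = 0 <-> exists w : 'rV_1, v = w *m h.
Proof.
split=> [v0|[w ->]]; last exact: cross_mx_self.
have ker1 (w : 'rV_1) : w *m h = 0 <-> exists k : 'rV[R]_0, w = k *m (0 : 'M[R]_(0, 1)).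
  by split=> [/koszul_triple0->|[k ->]]; [exists 0|]; rewrite mulmx0 ?mul0mx.
have ker2 (w : 'rV[R]_0) : w *m (0 : 'M[R]_(0, 1)) = 0 <-> exists k : 'rV[R]_0, w = k *m 0.
  by split=> _; [exists 0; rewrite !thinmx0 | rewrite mulmx0].
have [|||l rl] := koszul_rel_of_socle (x := t1) (y := t2) (z := t3) ker1 ker2 (u := v).
1-3: exact: koszul_triple_kill1.
apply: (koszul_rel_socle t123 ker1 ker2 _ rl (b1 := 0) (b2 := 0) (b3 := 0)).
  by move=> w _; rewrite thinmx0.
by rewrite !thinmx0.
Qed.

(** The same zigzag one place further along; the complex is continued by the zero module, so the
    bottom end [l] is zero. *)
Lemma koszul_triple2 v : v *m h^T = 0 <-> exists w : 'rV_3, v = w *m cross_mx h.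
Proof.
split=> [v0|[w ->]]; last exact: cross_mx_dot.
have ker2 (w : 'rV_1) : w *m h = 0 <-> exists k : 'rV[R]_0, w = k *m (0 : 'M[R]_(0, 1)).
  by split=> [/koszul_triple0->|[k ->]]; [exists 0|]; rewrite mulmx0 ?mul0mx.
have [|||l rl] := koszul_rel_of_socle (x := t1) (y := t2) (z := t3) koszul_triple1 ker2 (u := v).
1-3: exact: koszul_triple_kill2.
apply: (koszul_rel_socle t123 koszul_triple1 ker2 _ rl (b1 := 0) (b2 := 0) (b3 := 0)).
  by move=> w _; rewrite thinmx0.
by rewrite !thinmx0.
Qed.

End KoszulTriple.

Lemma big_ord2 (V : nmodType) (F : 'I_2 -> V) : \sum_i F i = F 0 + F 1.
Proof. by rewrite !big_ord_recl big_ord0 addr0; congr (F _ + F _); apply: val_inj. Qed.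

Section SocleTriple.
Variable K : fieldType.
Let S := {mpoly K[3]}.
Variables (t1 t2 t3 x y z : S) (h : 'rV[S]_3).
Hypothesis t123 : koszul_exact t1 t2 t3.
Hypothesis t1h : exists c : 'rV_3, t1%:M = c *m h^T.
Hypothesis t2h : exists c : 'rV_3, t2%:M = c *m h^T.
Hypothesis t3h : exists c : 'rV_3, t3%:M = c *m h^T.
Hypothesis xyz : koszul_exact x y z.
Hypothesis in_max_xyz : forall p : S, in_max p -> ideal3 x y z p.

(* The zigzag identifies the socle of [S / (h)] with a subspace of [S / (x, y, z) = K]. *)
Lemma socle_triple (u : 'I_2 -> 'rV[S]_1) :
  (forall i, exists p : 'rV_3, p *m h^T = x *: u i) ->
  (forall i, exists p : 'rV_3, p *m h^T = y *: u i) ->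
  (forall i, exists p : 'rV_3, p *m h^T = z *: u i) ->
  exists c : 'I_2 -> K, (exists i, c i != 0) /\
    exists p : 'rV_3, \sum_i (c i)%:MP *: u i = p *m h^T.
Proof.
move=> soc1 soc2 soc3.
have ker1 := koszul_triple2 t123 t1h t2h t3h.
have ker2 := koszul_triple1 t123 t1h t2h t3h.
have inj := koszul_triple0 t123 t1h.
have rel i : exists l, koszul_rel x y z h^T (cross_mx h) h (u i) l.
  exact: koszul_rel_of_socle.
have [[l0 r0] [l1 r1]] := (rel 0, rel 1).
(* Only the constant term of the bottom end matters modulo [(x, y, z)], and two scalars always
   satisfy a nontrivial linear relation. *)
pose a i : K := mcoeff 0%MM ((if i == 0 :> 'I_2 then l0 else l1) 0 0).
have [c [[i ci] ca]] : exists c : 'I_2 -> K, (exists i, c i != 0) /\ c 0 * a 0 + c 1 * a 1 = 0.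
  have [a0|a0] := eqVneq (a 0) 0.
    exists (fun i => (i == 0)%:R); split; first by exists 0; rewrite eqxx oner_neq0.
    by rewrite a0 mulr0 mul0r addr0.
  exists (fun i => if i == 0 then a 1 else - a 0); split; first by exists 1; rewrite oppr_eq0.
  by rewrite eqxx /=; ring.
exists c; split; first by exists i.
pose l := (c 0)%:MP *: l0 + (c 1)%:MP *: l1.
have /in_max_xyz[b1 [b2 [b3 lb]]] : in_max (l 0 0).
  by rewrite /in_max !mxE mcoeffD !mcoeffCM.
have rl : koszul_rel x y z h^T (cross_mx h) h ((c 0)%:MP *: u 0 + (c 1)%:MP *: u 1) l.
  rewrite -[_ *: u 1]addr0 /l -[_ *: l1]addr0; do 2!apply: koszul_rel_lin => //.
  exists 0, 0, 0; split; rewrite ?mul0mx ?scaler0 //.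
  by exists 0, 0, 0; split; rewrite ?mul0mx ?scaler0 ?addr0 ?subrr.
have lE : l = x *: b1%:M + y *: b2%:M + z *: b3%:M.
  by apply/rowP => j; rewrite ord1 lb !scale_scalar_mx -!raddfD !mxE eqxx mulr1n.
have [p e] := koszul_rel_socle xyz ker1 ker2 inj rl lE.
by exists p; rewrite -e big_ord2.
Qed.

End SocleTriple.

(** * Rank estimates *)

Section RankBounds.
Variable K : fieldType.

Lemma rank_le_of_indep m N a b (F : 'M[K]_(m, N)) (Z : 'M[K]_(a, N)) (D : 'M[K]_(b, N)) :
  (F <= Z)%MS -> (D <= Z)%MS -> (forall c : 'rV_m, (c *m F <= D)%MS -> c = 0) ->
  (m + \rank D <= \rank Z)%N.
Proof.
move=> FZ DZ indep.
have freeF : row_free F by apply: inj_row_free => c cF; apply: indep; rewrite cF sub0mx.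
have dis : (F :&: D)%MS = 0.
  apply/eqP/rowV0P => v; rewrite sub_capmx => /andP[/submxP[c ->] cD].
  by rewrite (indep _ cD) mul0mx.
rewrite -(eqP freeF) -(mxrank_disjoint_sum dis).
by apply: mxrankS; rewrite addsmx_sub FZ.
Qed.

(* With [C] the common kernel of [Y] and [Z], the map [a |-> (aY, aZ)] sends
   [U] to the kernel of [(p, q) |-> pZ - qY] on [B + B], and [X] maps [U :&: C]
   to [B :&: C]. *)
Lemma rank_socle_quotient n m k (X Y Z : 'M[K]_n) (B : 'M[K]_(m, n)) (U : 'M[K]_(k, n)) :
  X *m Y = Y *m X -> X *m Z = Z *m X -> Y *m Z = Z *m Y ->
  (U *m X <= B)%MS -> (U *m Y <= B)%MS -> (U *m Z <= B)%MS ->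
  (\rank U + \rank (B *m Y + B *m Z)%MS <=
   (\rank B).*2 + \rank (B :&: kermx (row_mx Y Z))%MS
   + \rank (kermx (row_mx X (row_mx Y Z))))%N.
Proof.
move=> XY XZ YZ UX UY UZ; set N := row_mx Y Z.
have XN m' (v : 'M_(m', n)) : v *m N = 0 -> v *m X *m N = 0.
  rewrite /N !mul_mx_row -!mulmxA XY XZ !mulmxA => /eqP.
  by rewrite row_mx_eq0 => /andP[/eqP-> /eqP->]; rewrite !mul0mx row_mx0.
have UN : (\rank (U *m N) + \rank (B *m Y + B *m Z)%MS <= (\rank B).*2)%N.
  pose D := block_mx B 0 0 B.
  have DN : D *m col_mx Z (- Y) = col_mx (B *m Z) (- (B *m Y)).
    by rewrite mul_block_col !mul0mx addr0 add0r mulmxN.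
  have -> : (\rank B).*2 = \rank D by rewrite rank_diag_block_mx addnn.
  rewrite -(mxrank_mul_ker D (col_mx Z (- Y))) DN addnC leq_add //.
    rewrite -addsmxE; apply: mxrankS; rewrite addsmx_sub addsmxSl andbT.
    by apply: submx_trans (addsmxSr _ _); rewrite eqmx_opp.
  apply: mxrankS; rewrite sub_capmx; apply/andP; split.
    have [a ea] := submxP UY; have [b eb] := submxP UZ.
    apply/submxP; exists (row_mx a b).
    by rewrite mul_row_block !mulmx0 addr0 add0r mul_mx_row ea eb.
  by apply/sub_kermxP; rewrite /N mul_mx_row mul_row_col mulmxN -!mulmxA YZ subrr.
pose V := (U :&: kermx N)%MS.
have VN : V *m N = 0 by apply/sub_kermxP; rewrite capmxSr.
have UV : (\rank V <= \rank (B :&: kermx N)%MS + \rank (kermx (row_mx X N)))%N.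
  rewrite -(mxrank_mul_ker V X) leq_add //; apply: mxrankS.
    rewrite sub_capmx; apply/andP; split.
      by apply: submx_trans UX; apply: submxMr; rewrite capmxSl.
    by apply/sub_kermxP; apply: XN.
  apply/sub_kermxP; rewrite mul_mx_row.
  have -> : (V :&: kermx X)%MS *m X = 0 by apply/sub_kermxP; rewrite capmxSr.
  have /submxP[a ->] : (V :&: kermx X <= V)%MS by rewrite capmxSl.
  by rewrite -mulmxA VN mulmx0 row_mx0.
by have := mxrank_mul_ker U N; rewrite -/V; lia.
Qed.

(** Each of the [e] multiplications by [X] loses at most the dimension of the common kernel of [X]
    and [N], and the last one reaches zero. *)
Lemma rank_nilpotent n m p (X : 'M[K]_n) (N : 'M[K]_(n, p)) e (W : 'M[K]_(m, n)) :
  (forall v : 'M[K]_(m, n), v *m N = 0 -> v *m X *m N = 0) ->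
  W *m N = 0 -> W *m iter e (mulmx X) 1%:M = 0 ->
  (\rank W <= e * \rank (kermx (row_mx X N)))%N.
Proof.
move=> XN; elim: e W => [|e IH] W WN /=; first by rewrite mulmx1 => ->; rewrite mxrank0.
rewrite mulmxA => We; rewrite mulSnr -(mxrank_mul_ker W X) leq_add //.
  by apply: IH => //; apply: XN.
apply: mxrankS; apply/sub_kermxP; rewrite mul_mx_row.
have -> : (W :&: kermx X)%MS *m X = 0 by apply/sub_kermxP; rewrite capmxSr.
have /submxP[a ->] : (W :&: kermx X <= W)%MS by rewrite capmxSl.
by rewrite -mulmxA WN mulmx0 row_mx0.
Qed.

(** The outer terms of the complex have dimension [n] and the middle ones [N], so the Euler
    characteristic vanishes; the non-surjectivity of [d1] makes the inequality strict. *)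
Lemma rank_koszul_euler N n k (d1 : 'M[K]_(N, n)) (d2 : 'M[K]_N)
    (d3 : 'M[K]_(n, N)) (W : 'M[K]_(k, N)) :
  (\rank d1 < n)%N -> (kermx d1 <= d2 + W)%MS ->
  (\rank (kermx d2) < \rank d3 + \rank (kermx d3) + k)%N.
Proof.
move=> d1n /mxrankS; have := mxrank_adds_leqif d2 W => -[le1 _] le2.
have := rank_leq_row W; move: le1 le2; rewrite !mxrank_ker.
by have := rank_leq_row d1; have := rank_leq_row d2; have := rank_leq_row d3; lia.
Qed.

End RankBounds.

(** * Finite-dimensional quotients *)

Section FiniteQuotient.
Variables (K : fieldType) (V : lmodType K) (P : V -> Prop).
Hypothesis P_lin : forall a u v, P u -> P v -> P (a *: u + v).
Hypothesis P0 : P 0.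

Definition spans_mod n (e : 'I_n -> V) := forall v, exists c : 'I_n -> K, P (v - \sum_i c i *: e i).

Lemma basis_mod n (e : 'I_n -> V) : spans_mod e ->
  exists m (b : 'I_m -> V), spans_mod b /\
    forall c : 'I_m -> K, P (\sum_i c i *: b i) -> forall i, c i = 0.
Proof.
elim: n e => [|n IH] e span_e; first by exists 0, e; split=> // c _ [].
have [[c [Pc [i ci]]]|indep] := boolp.EM (exists c : 'I_n.+1 -> K,
  P (\sum_i c i *: e i) /\ exists i, c i != 0); last first.
  exists n.+1, e; split=> // c Pc i; apply/eqP/negPn/negP => ci.
  by case: indep; exists c; split=> //; exists i.
apply: (IH (fun j => e (lift i j))) => v; have [a Pa] := span_e v.
(* The relation [c], scaled by [a i / c i], is subtracted so as to eliminate [e i]. *)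
exists (fun j => a (lift i j) - a i / c i * c (lift i j)).
have := P_lin (a i / c i) Pc Pa; congr P.
rewrite addrCA; congr (v + _).
rewrite (bigD1_ord i) //= [in X in _ - X](bigD1_ord i) //= scalerDr scalerA divfK //.
rewrite opprD addrACA subrr add0r scaler_sumr -!sumrN -big_split /=.
by apply: eq_bigr => j _; rewrite scalerBl opprB scalerA.
Qed.

(** Coordinates in a basis modulo [P] are unique, so the map that chooses them is linear. *)
Lemma finite_quotient n (e : 'I_n -> V) : spans_mod e ->
  exists m (pi : {linear V -> 'rV[K]_m}),
    (forall v, pi v = 0 <-> P v) /\ forall w, exists v, pi v = w.
Proof.
move=> /basis_mod[m [b [span_b indep]]].
pose comb (c : 'rV[K]_m) := \sum_i c 0 i *: b i.
have comb_lin : linear comb.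
  move=> a u v; rewrite /comb scaler_sumr -big_split; apply: eq_bigr => i _.
  by rewrite !mxE scalerDl scalerA.
have PB u v : P u -> P v -> P (u - v).
  by move=> Pu Pv; rewrite addrC -scaleN1r; apply: P_lin.
have comb0 c : P (comb c) -> c = 0.
  by move=> /indep c0; apply/rowP => i; rewrite c0 mxE.
have combD c c' : comb (c - c') = comb c - comb c'.
  by rewrite -[- c']scaleN1r addrC comb_lin scaleN1r addrC.
have uniq v c c' : P (v - comb c) -> P (v - comb c') -> c = c'.
  move=> Pc Pc'; apply/eqP; rewrite -subr_eq0; apply/eqP/comb0.
  by rewrite combD; have := PB _ _ Pc' Pc; rewrite opprB addrC addrA subrK.
have exc v : exists c : 'rV_m, P (v - comb c).
  have [c Pc] := span_b v; exists (\row_i c i).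
  by rewrite /comb; under eq_bigr => i _ do rewrite mxE.
pose f v := sval (boolp.cid (exc v)).
have fP v : P (v - comb (f v)) by rewrite /f; case: boolp.cid.
have f_lin : linear f.
  move=> a u v; apply: (uniq (a *: u + v)); first exact: fP.
  rewrite comb_lin opprD addrACA -scalerBr; exact: P_lin.
pose pi : {linear V -> 'rV[K]_m} := HB.pack_for {linear V -> 'rV[K]_m} f
  (GRing.isLinear.Build K V 'rV[K]_m _ f f_lin).
have comb00 : comb 0 = 0 by rewrite /comb big1 // => i _; rewrite mxE scale0r.
exists m, pi; split=> [v|w].
  split=> [e0|Pv]; first by have := fP v; rewrite (e0 : f v = 0) comb00 subr0.
  by apply: (uniq v); [exact: fP | rewrite comb00 subr0].
by exists (comb w); apply: (uniq (comb w)); [exact: fP | rewrite subrr].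
Qed.

End FiniteQuotient.

Lemma linear_factor (K : fieldType) (V : lmodType K) m
    (pi : {linear V -> 'rV[K]_m}) n (f : V -> 'rV[K]_n) :
  (forall w, exists v, pi v = w) -> linear f -> (forall v, pi v = 0 -> f v = 0) ->
  exists M : 'M[K]_(m, n), forall v, f v = pi v *m M.
Proof.
move=> sur f_lin ker; pose fL : {linear V -> 'rV[K]_n} := HB.pack_for {linear V -> 'rV[K]_n} f
  (GRing.isLinear.Build K V 'rV[K]_n _ f f_lin).
have /fin_all_exists[b bE] i : exists v, pi v = delta_mx 0 i by apply: sur.
exists (\matrix_i f (b i)) => v; rewrite -[f v]/(fL v).
have : fL (v - \sum_i pi v 0 i *: b i) = 0.
  apply: ker; rewrite linearB linear_sum /= [X in _ - X](_ : _ = pi v) ?subrr //.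
  rewrite [RHS]row_sum_delta; apply: eq_bigr => i _; by rewrite linearZ /= bE.
rewrite linearB linear_sum => /eqP; rewrite subr_eq0 => /eqP ->.
rewrite mulmx_sum_row; apply: eq_bigr => i _.
by rewrite linearZ rowK.
Qed.

(** * Algebraic dependence and prime chains *)

Lemma mpoly_dependent (K : fieldType) n (T : finType) (v : T -> {mpoly K[n]}) (s : seq 'X_{1..n}) :
  (forall t m, m \in msupp (v t) -> m \in s) -> (size s < #|T|)%N ->
  exists c : T -> K, (exists t, c t != 0) /\ \sum_t c t *: v t = 0.
Proof.
move=> supp lt_sT.
pose A : 'M[K]_(#|T|, size s) := \matrix_(i, j) (v (enum_val i))@_(nth 0%MM s j).
have : kermx A != 0.
  rewrite kermx_eq0; apply/negP => /eqP rk.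
  by have := rank_leq_col A; rewrite rk leqNgt lt_sT.
case/rowV0Pn => w /sub_kermxP wA w0.
exists (fun t => w 0 (enum_rank t)); split.
  have [i wi|w00] := pickP (fun i => w 0 i != 0); first by exists (enum_val i); rewrite enum_valK.
  by case/eqP: w0; apply/rowP => i; rewrite mxE; apply/eqP; rewrite -[_ == _]negbK w00.
apply/mpolyP => m; rewrite mcoeff0 raddf_sum /=.
have [/nthP-/(_ 0%MM)[j jlt mE]|nms] := boolP (m \in s); last first.
  rewrite big1 // => t _; rewrite mcoeffZ memN_msupp_eq0 ?mulr0 //.
  by apply: contra nms; apply: supp.
have /rowP/(_ (Ordinal jlt)) := wA; rewrite !mxE; apply: etrans.
rewrite (reindex (@enum_val T predT)) /=; last exact: onW_bij (enum_val_bij T).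
by apply: eq_bigr => i _; rewrite mcoeffZ enum_valK mxE /= mE.
Qed.

Lemma msize_mul_le (K : fieldType) n (p q : {mpoly K[n]}) D E :
  (msize p <= D.+1)%N -> (msize q <= E.+1)%N -> (msize (p * q) <= (D + E).+1)%N.
Proof.
have [->|p0] := eqVneq p 0; first by rewrite mul0r msize0.
have [->|q0] := eqVneq q 0; first by rewrite mulr0 msize0.
by rewrite msizeM //; move: (msize p) (msize q) => a b; lia.
Qed.

Lemma msize_exp_le (K : fieldType) n (p : {mpoly K[n]}) D k :
  (msize p <= D.+1)%N -> (msize (p ^+ k) <= (D * k).+1)%N.
Proof.
move=> pD; elim: k => [|k IH]; first by rewrite expr0 msize1.
by rewrite exprS mulnS; apply: msize_mul_le.
Qed.

(** The products of four powers below [N] number [N ^ 4], while the monomials available to them grow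
    only like [N ^ 3]. *)
Lemma mpoly3_alg_dependent (K : fieldType) (p0 p1 p2 p3 : {mpoly K[3]}) :
  exists N (c : 'I_N * 'I_N * 'I_N * 'I_N -> K), (exists t, c t != 0) /\
    \sum_t c t *: (p0 ^+ t.1.1.1 * p1 ^+ t.1.1.2 * p2 ^+ t.1.2 * p3 ^+ t.2) = 0.
Proof.
pose D := (msize p0 + msize p1 + msize p2 + msize p3)%N.
(* [L] exceeds the degree of every product, and [N] is such that
   [L ^ 3 < (5 * D.+1 * N) ^ 3 = N ^ 4]. *)
pose N := (125 * D.+1 ^ 3)%N; pose L := (4 * D * N).+1.
pose s := [seq [multinom (u i : nat) | i < 3] | u : {ffun 'I_3 -> 'I_L}].
exists N; apply: (mpoly_dependent (s := s)) => [t m mt|].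
  have mL : (mdeg m < L)%N.
    apply: leq_trans (msize_mdeg_lt mt) _.
    have lt (i : 'I_N) : (i <= N)%N by apply: ltnW.
    have pD (p : S3 K) (i : 'I_N) : (msize p <= D)%N -> (msize (p ^+ i) <= (D * N).+1)%N.
      move=> pD; apply: (leq_trans (msize_exp_le i (leqW pD))).
      by rewrite ltnS leq_mul2l lt orbT.
    rewrite (_ : L = (D * N + D * N + D * N + D * N).+1); last by rewrite /L; lia.
    apply: msize_mul_le; [apply: msize_mul_le; [apply: msize_mul_le|]|]; apply: pD.
    - by rewrite /D -!addnA leq_addr.
    - by rewrite /D -!addnA addnCA leq_addr.
    - by rewrite /D addnAC leq_addl.
    - by rewrite /D leq_addl.
  have mi i : (m i < L)%N.
    by apply: leq_ltn_trans mL; rewrite mdegE (bigD1 i) //= leq_addr.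
  apply/imageP; exists [ffun i => Ordinal (mi i)] => //.
  by apply/mnmP => i; rewrite mnmE ffunE.
rewrite size_map -cardE card_ffun !card_prod !card_ord.
have N0 : (0 < N)%N by rewrite /N muln_gt0 expn_gt0.
apply: (@leq_trans ((5 * D.+1 * N) ^ 3)).
  by rewrite ltn_exp2r // /L; nia.
rewrite expnMn (_ : ((5 * D.+1) ^ 3 = N)%N); last by rewrite expnMn.
by rewrite -!mulnA !expnS expn0 muln1.
Qed.

Section Primes.
Variable K : fieldType.
Local Notation S := (S3 K).
Implicit Types I J P Q : S -> Prop.

Lemma ideal_sum I (T : Type) (r : seq T) (A : pred T) (F : T -> S) :
  is_ideal I -> (forall i, A i -> I (F i)) -> I (\sum_(i <- r | A i) F i).
Proof. by move=> [I0 [ID _]] IF; elim/big_ind: _. Qed.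

Lemma ideal_scale I c p : is_ideal I -> I p -> I (c *: p).
Proof. by move=> [_ [_ IM]] Ip; rewrite -mul_mpolyC; apply: IM. Qed.

Lemma ideal_opp I p : is_ideal I -> I p -> I (- p).
Proof. by move=> [_ [_ IM]] Ip; rewrite -mulN1r; apply: IM. Qed.

Lemma ideal_sub I p q : is_ideal I -> I p -> I q -> I (p - q).
Proof. by move=> idI Ip Iq; apply: idI.2.1 => //; apply: ideal_opp. Qed.

(* The coefficient of the lowest power of [b] must lie in [Q]. *)
Lemma prime_dependent_step P Q b (T : finType) N (c : T * 'I_N -> K) (F : T -> S) :
  is_prime_ideal P -> is_prime_ideal Q -> (forall p, P p -> Q p) -> Q b -> ~ P b ->
  (exists t, c t != 0) -> P (\sum_t c t *: (F t.1 * b ^+ t.2)) ->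
  exists c' : T -> K, (exists t, c' t != 0) /\ Q (\sum_t c' t *: F t).
Proof.
move=> [idP [_ prP]] [idQ [Q1 prQ]] PQ Qb nPb [[t0 k0] ck0] Psum.
have ex : exists k : nat, [exists t : T, exists i : 'I_N, (i == k :> nat) && (c (t, i) != 0)].
  by exists k0; apply/existsP; exists t0; apply/existsP; exists k0; rewrite eqxx.
case: (ex_minnP ex) => k /existsP[t /existsP[i /andP[/eqP ik cti]]] kmin.
exists (fun t => c (t, i)); split; first by exists t.
pose f (j : 'I_N) := \sum_t c (t, j) *: F t.
have fj (j : 'I_N) : (j < k)%N -> f j = 0.
  move=> jk; apply: big1 => t' _; have [->|cj] := eqVneq (c (t', j)) 0; first by rewrite scale0r.
  have := kmin j; rewrite leqNgt jk /= => h; suff: false by []; apply: h.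
  by apply/existsP; exists t'; apply/existsP; exists j; rewrite eqxx.
have sumE : \sum_t c t *: (F t.1 * b ^+ t.2) =
    b ^+ k * (f i + \sum_(j < N | (k < j)%N) b ^+ (j - k) * f j).
  transitivity (\sum_(j < N) f j * b ^+ j).
    transitivity (\sum_t' \sum_(j < N) c (t', j) *: (F t' * b ^+ j)).
      by rewrite pair_bigA; apply: eq_bigr => -[].
    rewrite exchange_big; apply: eq_bigr => j _; rewrite mulr_suml.
    by apply: eq_bigr => t' _; rewrite scalerAl.
  rewrite (bigD1 i) //= mulrDr ik mulrC; congr (_ + _).
  rewrite mulr_sumr big_mkcond [RHS]big_mkcond; apply: eq_bigr => j _.
  have [->|ji] := eqVneq j i; first by rewrite ik ltnn.
  case: (ltngtP k j) => [kj|jk|jk] /=; last 2 first.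
    by rewrite fj ?mul0r.
    by case/eqP: ji; apply: ord_inj; rewrite ik.
  by rewrite mulrA -exprD subnKC 1?mulrC // ltnW.
(* As [b] is outside the prime [P], the factor [b ^+ k] cancels; the terms beyond [f i] are
   multiples of [b], hence in [Q]. *)
have Pbk n p : P (b ^+ n * p) -> P p.
  by elim: n => [|n IH]; rewrite ?expr0 ?mul1r // exprS -mulrA => /prP[].
have := Psum; rewrite sumE => /Pbk/PQ Qf.
rewrite -[X in Q X](addrK (\sum_(j < N | (k < j)%N) b ^+ (j - k) * f j)).
apply: ideal_sub => //; apply: ideal_sum => // j kj.
have -> : b ^+ (j - k) * f j = (b ^+ (j - k).-1 * f j) * b.
  by rewrite -[in LHS](prednK (n := j - k)) ?subn_gt0 // exprS; ring.
exact: idQ.2.2.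
Qed.

(* A maximal element among the ideals that contain [J] and avoid [W]. *)
Lemma prime_avoiding J (W : S -> Prop) :
  is_ideal J -> W 1 -> (forall p q, W p -> W q -> W (p * q)) -> (forall p, J p -> ~ W p) ->
  exists P, [/\ is_prime_ideal P, forall p, J p -> P p & forall p, P p -> ~ W p].
Proof.
move=> idJ W1 WM JW.
pose good (I : S -> Prop) := [/\ is_ideal I, forall p, J p -> I p & forall p, I p -> ~ W p].
have [] := @classical_sets.Zorn_bigcup S (fun I => good I \/ forall p, ~ I p).
  move=> F Fgood Ftot.
  have [[I0 [FI0 gI0]]|none] := boolp.EM (exists I, F I /\ good I); last first.
    right=> p [I FI Ip]; case: (Fgood _ FI) => [gI|]; last by apply; exact: Ip.
    by apply: none; exists I.
  left; have goodF I p : F I -> I p -> good I.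
    by move=> FI Ip; case: (Fgood _ FI) => // /(_ p).
  split; last 2 first.
  - by move=> p Jp; exists I0 => //; case: gI0 => _ + _; apply.
  - by move=> p [I FI Ip]; case: (goodF _ _ FI Ip) => _ _; apply.
  split; first by exists I0 => //; case: gI0 => -[].
  split=> [p q [I FI Ip] [I' FI' Iq]|r p [I FI Ip]]; last first.
    by exists I => //; case: (goodF _ _ FI Ip) => -[_ [_ +]] _ _; apply.
  case: (Ftot _ _ FI FI') => [sub|sub].
    by exists I' => //; case: (goodF _ _ FI' Iq) => -[_ [+ _]] _ _; apply=> //; apply: sub.
  by exists I => //; case: (goodF _ _ FI Ip) => -[_ [+ _]] _ _; apply=> //; apply: sub.
move=> P [goodP maxP]; exists P.
have {}maxP I : good I -> (forall p, P p -> I p) -> forall p, I p -> P p.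
  move=> gI PI p Ip; apply: boolp.contrapT => nPp.
  by apply: (maxP I); [split=> // /(_ p Ip) | left].
have {}goodP : good P.
  case: goodP => // Pe; have gJ : good J by split.
  by case: (Pe 0); apply: (maxP J) => // [p /Pe //|]; exact: idJ.1.
case: (goodP) => idP JP PW; split=> //; split=> //; split; first by move/PW; apply.
(* By maximality, the ideal generated by [P] and an element outside [P] meets [W]. *)
have meets p : ~ P p -> exists a b, P a /\ W (a + b * p).
  move=> nPp; apply: boolp.contrapT => nW.
  pose I q := exists a b, P a /\ q = a + b * p.
  apply: nPp; apply: (maxP I); last 1 first.
  - by exists 0, 1; split; [exact: idP.1 | rewrite add0r mul1r].
  - split=> [|q Jq|q [a [b [Pa ->]]] Wq]; last 2 first.
    + by exists q, 0; split; [exact: JP | rewrite mul0r addr0].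
    + by apply: nW; exists a, b.
    split; first by exists 0, 0; split; [exact: idP.1 | rewrite mul0r addr0].
    split=> [q q' [a [b [Pa ->]]] [a' [b' [Pa' ->]]]|r q [a [b [Pa ->]]]].
      by exists (a + a'), (b + b'); split; [exact: idP.2.1 | ring].
    by exists (r * a), (r * b); split; [exact: idP.2.2 | ring].
  - by move=> q Pq; exists q, 0; split=> //; rewrite mul0r addr0.
move=> p q Ppq; apply: boolp.contrapT =>
  /boolp.not_orP[/meets[a [b [Pa Wa]]] /meets[a' [b' [Pa' Wb]]]].
apply: (PW _ _ (WM _ _ Wa Wb)).
rewrite (_ : _ * _ = (a' + b' * q) * a + (b * p * a' + (b * b') * (p * q))); last by ring.
by apply: idP.2.1; [exact: idP.2.2 | apply: idP.2.1; exact: idP.2.2].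
Qed.

(** Every [a] is algebraic modulo [P]: take elements [b1, b2, b3] that are new at each step of the
    chain, start from a relation among [a, b3, b2, b1], and eliminate [b1], [b2], [b3] while
    climbing. *)
Lemma prime_height3_dependent P (a : S) : is_prime_ideal P -> has_prime_chain P 3 ->
  exists N (c : 'I_N -> K), (exists i, c i != 0) /\ P (\sum_i c i *: a ^+ i).
Proof.
move=> prP [C [prC [Clt CP]]].
have [C01 [b1 [b11 b10]]] := Clt 0%N isT.
have [C12 [b2 [b22 b21]]] := Clt 1%N isT.
have [C23 [b3 [b33 b32]]] := Clt 2%N isT.
have [N [c [c0 e]]] := mpoly3_alg_dependent a b3 b2 b1.
have e0 : C 0%N (\sum_t c t *: (a ^+ t.1.1.1 * b3 ^+ t.1.1.2 * b2 ^+ t.1.2 * b1 ^+ t.2)).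
  by rewrite e; have [[]] := prC 0%N isT.
have [c1 [c10 e1]] := prime_dependent_step
  (F := fun t : 'I_N * 'I_N * 'I_N => a ^+ t.1.1 * b3 ^+ t.1.2 * b2 ^+ t.2)
  (prC 0%N isT) (prC 1%N isT) C01 b11 b10 c0 e0.
have [c2 [c20 e2]] := prime_dependent_step (F := fun t : 'I_N * 'I_N => a ^+ t.1 * b3 ^+ t.2)
  (prC 1%N isT) (prC 2%N isT) C12 b22 b21 c10 e1.
have [c3 [c30 e3]] := prime_dependent_step (F := fun t : 'I_N => a ^+ t)
  (prC 2%N isT) (prC 3%N isT) C23 b33 b32 c20 e2.
by exists N, c3; split=> //; apply/CP.
Qed.

End Primes.

(** * Homogeneous forms over an infinite field *)

Section InfiniteField.
Variable K : fieldType.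
Hypothesis hK : infinite_type K.

Lemma nonroot_exists (q : {poly K}) : q != 0 -> exists a, q.[a] != 0.
Proof.
move=> q0.
have [rs [urs szrs]] : exists rs : seq K, uniq rs /\ size rs = size q.
  elim: (size q) => [|k [rs [urs szrs]]]; first by exists [::].
  by have [x xrs] := hK rs; exists (x :: rs); rewrite /= xrs szrs.
have [/(max_poly_roots q0)/(_ urs)|] := boolP (all (root q) rs); first by rewrite szrs ltnn.
by case/allPn => a _ nra; exists a.
Qed.

Lemma digits_inj B n (f g : 'I_n -> nat) :
  (forall i, f i < B)%N -> (forall i, g i < B)%N ->
  (\sum_i f i * B ^ i = \sum_i g i * B ^ i)%N -> f =1 g.
Proof.
elim: n f g => [|n IH] f g fB gB; first by move=> _ [].
have B0 : (0 < B)%N by apply: leq_ltn_trans (fB ord0).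
have split_sum (h : 'I_n.+1 -> nat) :
    (\sum_i h i * B ^ i = (\sum_(i < n) h (lift ord0 i) * B ^ i) * B + h ord0)%N.
  rewrite big_ord_recl expn0 muln1 addnC big_distrl; congr (_ + _)%N.
  by apply: eq_bigr => i _ /=; rewrite -mulnA -expnSr.
rewrite !split_sum => e.
have e0 : f ord0 = g ord0.
  by have := congr1 (modn^~ B) e; rewrite !modnMDl !modn_small.
have e1 : (fun i => f (lift ord0 i)) =1 (fun i => g (lift ord0 i)).
  apply: IH => //.
  by move/eqP: e; rewrite e0 eqn_add2r eqn_pmul2r // => /eqP.
by move=> i; case: (unliftP ord0 i) => [j ->|->].
Qed.

(* Kronecker substitution [X_i := a ^ (B ^ i)]. *)
Lemma mpoly_nonzero_exists n (F : {mpoly K[n]}) : F != 0 -> exists v, F.@[v] != 0.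
Proof.
move=> F0; pose B := (msize F).+1.
pose kap (m : 'X_{1..n}) := (\sum_i m i * B ^ i)%N.
pose q := \sum_(m <- msupp F) F@_m *: 'X^(kap m) : {poly K}.
have mB m i : m \in msupp F -> (m i < B)%N.
  move/msize_mdeg_lt => mF; apply: leq_ltn_trans (leqW mF).
  by rewrite mdegE (bigD1 i) //= leq_addr.
have [|a qa] := @nonroot_exists q.
  apply: contraNneq F0 => q0; apply/eqP/mpolyP => m; rewrite mcoeff0.
  have [mF|/memN_msupp_eq0 //] := boolP (m \in msupp F).
  have := congr1 (fun r : {poly K} => r`_(kap m)) q0.
  rewrite coef0 coef_sum (bigD1_seq m) ?msupp_uniq //= coefZ coefXn eqxx mulr1.
  rewrite big_seq_cond big1 ?addr0 // => m' /andP[m'F m'm].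
  rewrite coefZ coefXn; case: eqP => [/digits_inj e|]; last by rewrite mulr0.
  by case/eqP: m'm; apply/mnmP => i; apply/esym/e => j; apply: mB.
exists (fun i => a ^+ (B ^ i)); rewrite mevalE; apply: contraNneq qa => e.
rewrite horner_sum -[X in _ == X]e; apply/eqP/eq_bigr => m _.
rewrite hornerZ hornerXn; congr (_ * _).
rewrite /kap expr_sum; apply: eq_bigr => i _.
by rewrite -exprM mulnC.
Qed.

Lemma meval_homog n (F : {mpoly K[n]}) e a w : F \is e.-homog ->
  F.@[fun i => a * w i] = a ^+ e * F.@[w].
Proof.
move=> /dhomogP hF; rewrite !mevalE mulr_sumr; apply: eq_big_seq => m /hF me.
under eq_bigr => i _ do rewrite exprMn.
by rewrite big_split /= prodrXr -mdegE me mulrCA.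
Qed.

(** A nonzero of ['X_ord0 * F] has a nonzero first coordinate, and homogeneity allows rescaling that
    coordinate to 1. *)
Lemma homog_nonzero_point n (F : {mpoly K[n.+1]}) e : F \is e.-homog -> F != 0 ->
  exists w, w ord0 = 1 /\ F.@[w] != 0.
Proof.
move=> hF F0; have [|v] := @mpoly_nonzero_exists _ ('X_ord0 * F).
  by rewrite mulf_neq0 // -msize_poly_eq0 msizeX.
rewrite mevalM mevalXU mulf_eq0 negb_or => /andP[v0 Fv].
exists (fun i => v i / v ord0); split; first by rewrite divff.
apply: contraNneq Fv => Fw.
rewrite (meval_eq (v2 := fun i => v ord0 * (v i / v ord0))) => [|i]; last by rewrite mulrC divfK.
by rewrite (meval_homog _ _ hF) Fw mulr0.
Qed.

End InfiniteField.

Section Homogeneous.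
Variable K : fieldType.
Local Notation S := (S3 K).

Lemma mcoeff_pihomog n e (F : {mpoly K[n]}) m :
  (pihomog mdeg e F)@_m = if mdeg m == e then F@_m else 0.
Proof.
case: eqP => me; last first.
  by apply: dhomog_nemf_coeff (pihomogP _ _ _) _; apply/eqP.
rewrite [in RHS](pihomog_partitionE (leq_maxl (msize F) e.+1)).
have ek : (e < maxn (msize F) e.+1)%N by rewrite leq_max ltnSn orbT.
rewrite (bigD1 (Ordinal ek)) //= mcoeffD [X in _ = _ + X]raddf_sum
  [X in _ = _ + X]big1 ?addr0 //= => j ne.
apply: dhomog_nemf_coeff (pihomogP _ _ _) _.
by rewrite [X in X != _]me eq_sym; apply: contraNneq ne => je; apply/eqP/val_inj.
Qed.

Lemma pihomogM_homog n d e (a h : {mpoly K[n]}) : h \is d.-homog ->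
  pihomog mdeg e (a * h) = if (d <= e)%N then pihomog mdeg (e - d) a * h else 0.
Proof.
move=> hh; pose k := maxn (msize a) e.+1.
rewrite {1}(pihomog_partitionE (leq_maxl (msize a) e.+1)) -/k mulr_suml raddf_sum /=.
have pi_j (j : 'I_k) : pihomog mdeg e (pihomog mdeg j a * h) =
    if (j + d == e)%N then pihomog mdeg j a * h else 0.
  have hj : pihomog mdeg j a * h \is (j + d).-homog by apply: dhomogM => //; apply: pihomogP.
  case: eqP => [<-|/eqP ne]; first exact: pihomog_dE.
  exact: pihomog_ne0 hj.
under eq_bigr => j _ do rewrite pi_j.
case: ifP => [de|/negbT nde]; last first.
  by rewrite big1 // => j _; case: eqP => // je; case/negP: nde; rewrite -je leq_addl.
have edk : (e - d < k)%N by rewrite leq_max ltnS leq_subr orbT.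
rewrite (bigD1 (Ordinal edk)) //= subnK // eqxx big1 ?addr0 // => j ne.
case: eqP => // je; case/eqP: ne; apply: val_inj => /=; lia.
Qed.

(** Modulo [I] the point [y] lies on the line [w *: t], where a form of degree [e] is
    [F(w) * t ^ e]. It serves both for the forms [g i] and for the variables. *)
Lemma homog_meval_congr (I : S -> Prop) n (F : {mpoly K[n]}) e (y : 'I_n -> S) (w : 'I_n -> K) t :
  is_ideal I -> F \is e.-homog -> (forall i, I (y i - w i *: t)) ->
  I (mmap (@mpolyC 3 K) y F - F.@[w] *: t ^+ e).
Proof.
move=> idI /dhomogP hF ywt; rewrite /mmap mevalE scaler_suml -sumrB big_seq.
apply: ideal_sum => // m /hF me; rewrite mul_mpolyC -scalerA -scalerBr.
apply: ideal_scale => //.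
have -> : (\prod_i w i ^+ m i) *: t ^+ e = \prod_i (w i *: t) ^+ m i.
  have <- : (\sum_i m i)%N = e by rewrite -mdegE.
  rewrite -prodrXr -mul_mpolyC rmorph_prod -big_split; apply: eq_bigr => i _ /=.
  by rewrite exprZn mul_mpolyC.
have congrM a b c d : I (a - b) -> I (c - d) -> I (a * c - b * d).
  move=> ab cd; rewrite (_ : _ - _ = c * (a - b) + b * (c - d)); last by ring.
  by apply: idI.2.1; apply: idI.2.2.
rewrite /mmap1; elim/big_ind2: _ => [|a b c d|i _]; first by rewrite subrr; exact: idI.1.
  exact: congrM.
by elim: (m i) => [|k IH]; rewrite ?expr0 ?subrr ?exprS; [exact: idI.1 | exact: congrM].
Qed.

Lemma monomials_of_degree n d : exists s : seq 'X_{1..n.+1},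
  [/\ uniq s, size s = 'C(d + n, d) & forall m, (m \in s) = (mdeg m == d)].
Proof.
eexists; split; [exact: (uniq_basis n.+1 d) | exact: size_basis |].
by move=> m; rewrite basis_cover.
Qed.

Variables (d : nat) (g : 'I_4 -> S).
Hypothesis hg : forall i, g i \is d.-homog.

Lemma ideal_gen_ideal : is_ideal (ideal_gen g).
Proof.
split; first by exists (fun _ => 0); rewrite big1 // => i _; rewrite mul0r.
split=> [p q [a ->] [b ->]|r p [a ->]].
  by exists (fun i => a i + b i); rewrite -big_split; apply: eq_bigr => i _; rewrite mulrDl.
by exists (fun i => r * a i); rewrite mulr_sumr; apply: eq_bigr => i _; rewrite mulrA.
Qed.

Lemma ideal_gen_gen i : ideal_gen g (g i).
Proof.
exists (fun j => (j == i)%:R); rewrite (bigD1 i) //= eqxx mul1r big1 ?addr0 // => j /negPf->.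
by rewrite mul0r.
Qed.

Lemma ideal_gen_pihomog e p : ideal_gen g p -> ideal_gen g (pihomog mdeg e p).
Proof.
case=> c ->; rewrite raddf_sum /=; apply: ideal_sum => [|i _]; first exact: ideal_gen_ideal.
rewrite (pihomogM_homog _ _ (hg i)); case: ifP => _; last exact: ideal_gen_ideal.1.
by apply: ideal_gen_ideal.2.2; apply: ideal_gen_gen.
Qed.

(* The multiplicative set of nonzero polynomials in ['X_i] avoids the
   homogeneous ideal unless a power of ['X_i] is in it. *)
Lemma height3_power (i : 'I_3) : height_ge (ideal_gen g) 3 -> exists N, ideal_gen g ('X_i ^+ N).
Proof.
move=> ht; apply: boolp.contrapT => noN.
pose W (p : S) := exists2 f : {poly K}, f != 0 & p = horner_alg 'X_i f.
have W1 : W 1 by exists 1; rewrite ?oner_neq0 ?rmorph1.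
have WM p q : W p -> W q -> W (p * q).
  by move=> [f f0 ->] [f' f'0 ->]; exists (f * f'); rewrite ?mulf_neq0 ?rmorphM.
have hornerZX (a : K) k : horner_alg 'X_i (a *: 'X^k) = a *: ('X_i ^+ k : S).
  by rewrite -mul_polyC rmorphM rmorphXn /= horner_algC horner_algX mulr_algl.
have hornerE (f : {poly K}) : horner_alg 'X_i f = \sum_(k < size f) f`_k *: ('X_i ^+ k : S).
  by rewrite -[in LHS](coefK f) poly_def linear_sum; apply: eq_bigr => k _; apply: hornerZX.
have piX k e : pihomog mdeg e ('X_i ^+ k : S) = if k == e then 'X_i ^+ k else 0.
  have mX : mdeg (U_(i) *+ k) = k by rewrite mdegMn mdeg1 mul1n.
  by rewrite mpolyXn pihomogX [X in if X == _ then _ else _]mX.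
have JW p : ideal_gen g p -> ~ W p.
  move=> Jp [f f0 pE]; apply: noN; exists (size f).-1.
  (* The homogeneous ideal contains the top component of [p], a nonzero multiple of a power of
     ['X_i]. *)
  have := ideal_gen_pihomog (size f).-1 Jp.
  have szf : ((size f).-1 < size f)%N by rewrite prednK // size_poly_gt0.
  rewrite pE hornerE raddf_sum (bigD1 (Ordinal szf)) //= big1 => [|k kne].
    rewrite addr0 linearZ /= piX eqxx => Jl.
    have /(ideal_scale (lead_coef f)^-1 ideal_gen_ideal) := Jl.
    by rewrite scalerA mulVf ?lead_coef_eq0 // scale1r.
  rewrite linearZ /= piX.
  case: eqP => [ke|]; last by rewrite scaler0.
  by case/eqP: kne; apply: val_inj.
have [P [prP JP PW]] := prime_avoiding ideal_gen_ideal W1 WM JW.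
have [N [c [[j cj] Pc]]] := prime_height3_dependent 'X_i prP (ht P prP JP).
apply: (PW _ Pc).
exists (\poly_(k < N) (if insub k is Some k' then c k' else 0)).
  apply/eqP => /(congr1 (fun r : {poly K} => r`_j)); rewrite coef_poly ltn_ord coef0 valK => /eqP.
  by rewrite (negPf cj).
rewrite poly_def linear_sum; apply: eq_bigr => k _.
by rewrite valK; apply/esym/hornerZX.
Qed.

(** If [d = 0] the generators are constants. A nonzero one leaves no prime above the ideal, so
    [height_ge] holds vacuously for 4; if all vanish, no power of a variable is in the ideal. *)
Lemma height3_degree : height_eq (ideal_gen g) 3 -> (0 < d)%N.
Proof.
move=> [ht3 ht4]; rewrite lt0n; apply/eqP => d0.
have gC i : g i = (mcoeff 0%MM (g i))%:MP.
  apply/mpolyP => m; rewrite mcoeffC; case: eqP => [->|/eqP m0]; first by rewrite mulr1.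
  by rewrite mulr0 (dhomog_nemf_coeff (hg i)) // d0 mdeg_eq0.
have g0 i : g i = 0.
  apply/eqP; apply: boolp.contrapT => /negP gi; apply: ht4 => P prP JP; case: (prP.2.1).
  have : P (g i) by apply/JP/ideal_gen_gen.
  move/(ideal_scale (mcoeff 0%MM (g i))^-1 prP.1); rewrite {2}gC -mul_mpolyC -mpolyCM.
  by rewrite mulVf ?mpolyC1 // -(mpolyC_eq0 3) -gC.
have [N [c]] := height3_power 0 ht3.
rewrite big1 => [/eqP|i _]; last by rewrite g0 mulr0.
by rewrite mpolyXn -msize_poly_eq0 msizeX.
Qed.

Lemma ideal_gen_in_max p : (0 < d)%N -> ideal_gen g p -> in_max p.
Proof.
move=> d0 [c ->]; rewrite /in_max raddf_sum big1 //= => i _.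
rewrite rmorphM /= (dhomog_nemf_coeff (hg i)) ?mulr0 //.
by rewrite [X in X != _]mdeg0 eq_sym -lt0n.
Qed.

End Homogeneous.

(** * Homogeneous relations among the four forms *)

Section Reduction.
Variables (K : fieldType) (d : nat) (g : 'I_4 -> S3 K).
Hypothesis hg : forall i, g i \is d.-homog.
Local Notation S := (S3 K).

(** The ideal of the entries of [h], in the matrix form of the hypotheses on the Koszul complex of a
    triple. *)
Definition ideal_row (h : 'rV[S]_3) (p : S) : Prop := exists c : 'rV_3, p%:M = c *m h^T.

Lemma ideal_row_ideal h : is_ideal (ideal_row h).
Proof.
split; first by exists 0; rewrite mul0mx raddf0.
split=> [p q [a pa] [b qb]|r p [a pa]].
  by exists (a + b); rewrite mulmxDl -pa -qb raddfD.
by exists (r *: a); rewrite -scalemxAl -pa scale_scalar_mx.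
Qed.

Lemma ideal_row_gen h j : ideal_row h (h 0 j).
Proof.
exists (delta_mx 0 j); rewrite -rowE; apply/rowP => i.
by rewrite !ord1 !mxE eqxx mulr1n.
Qed.

(** Substituting forms of degree [d] multiplies degrees by [d]; as [d] is positive, distinct degrees
    stay distinct. *)
Lemma mmap_pihomog n (y : 'I_n -> S) (F : {mpoly K[n]}) e :
  (0 < d)%N -> (forall i, y i \is d.-homog) ->
  mmap (@mpolyC 3 K) y (pihomog mdeg e F) = pihomog mdeg (d * e) (mmap (@mpolyC 3 K) y F).
Proof.
move=> d0 hy; rewrite [mmap _ _ F]/mmap pihomogE !raddf_sum /= big_mkcond.
apply: eq_bigr => m _.
have hm : mmap1 y m \is (d * mdeg m).-homog.
  rewrite /mmap1 mdegE big_distrr /=.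
  elim/big_rec2: _ => [|i k p _ hp]; first exact: dhomog1.
  by apply: dhomogM => //; rewrite ?dhomogMn.
rewrite mul_mpolyC linearZ /=; case: eqP => me.
  by rewrite mmapZ mmapX mul_mpolyC pihomog_dE // -me.
rewrite (@pihomog_ne0 _ _ _ (d * mdeg m)) ?scaler0 //.
by rewrite eqn_mul2l negb_or -lt0n d0; apply/eqP.
Qed.

Lemma prod_ord4 (F : 'I_4 -> S) : \prod_i F i = F 0 * F 1 * F 2%:R * F 3%:R.
Proof.
rewrite !big_ord_recl big_ord0 mulr1 !mulrA.
by congr (F _ * F _ * F _ * F _); apply: val_inj.
Qed.

Lemma homog_relation : (0 < d)%N -> exists (F : {mpoly K[4]}) e,
  [/\ F \is e.-homog, F != 0 & mmap (@mpolyC 3 K) g F = 0].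
Proof.
move=> d0; have [N [c [[t0 ct0] rel]]] := mpoly3_alg_dependent (g 0) (g 1) (g 2%:R) (g 3%:R).
pose T := ('I_N * 'I_N * 'I_N * 'I_N)%type.
pose m (t : T) : 'X_{1..4} := [multinom
  nth 0%N [:: t.1.1.1 : nat; t.1.1.2 : nat; t.1.2 : nat; t.2 : nat] i | i < 4].
have m_inj : injective m.
  move=> [[[a b] a'] b'] [[[u v] u'] v'] /mnmP e.
  have := (e 0, e 1, e 2%:R, e 3%:R); rewrite !mnmE /= => -[[[e0 e1] e2] e3].
  by congr (_, _, _, _); apply: val_inj.
pose F := \sum_t c t *: 'X_[m t].
have Fc t : F@_(m t) = c t.
  rewrite raddf_sum (bigD1 t) //= mcoeffZ mcoeffX eqxx mulr1 big1 ?addr0 // => t' t't.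
  by rewrite mcoeffZ mcoeffX (inj_eq m_inj) (negPf t't) mulr0.
have Fg : mmap (@mpolyC 3 K) g F = 0.
  rewrite -[RHS]rel raddf_sum; apply: eq_bigr => t _ /=.
  rewrite mmapZ mmapX mul_mpolyC; congr (_ *: _).
  have n0 : nat_of_ord (0 : 'I_4) = 0%N by [].
  have n1 : nat_of_ord (1 : 'I_4) = 1%N by [].
  have n2 : nat_of_ord (2%:R : 'I_4) = 2%N by [].
  have n3 : nat_of_ord (3%:R : 'I_4) = 3%N by [].
  by rewrite /mmap1 prod_ord4 !mnmE n0 n1 n2 n3.
(* Each homogeneous component of a relation is a relation; the chosen one contains a nonzero
   coefficient. *)
exists (pihomog mdeg (mdeg (m t0)) F), (mdeg (m t0)); split; first exact: pihomogP.
  apply: contraNneq ct0 => /(congr1 (mcoeff (m t0))).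
  by rewrite mcoeff0 mcoeff_pihomog eqxx Fc => ->.
by rewrite mmap_pihomog // Fg raddf0.
Qed.

End Reduction.

(** * The general triple *)

Section GeneralTriple.
Variables (K : fieldType) (d : nat) (g : 'I_4 -> S3 K).
Hypothesis hK : infinite_type K.
Hypothesis hg : forall i, g i \is d.-homog.
Hypothesis d_gt0 : (0 < d)%N.
Local Notation S := (S3 K).

(* Modulo this triple, every generator [g i] becomes [w i *: g 0]. *)
Definition shear_row (w : 'I_4 -> K) : 'rV[S]_3 :=
  \row_j (g (lift 0 j) - w (lift 0 j) *: g 0).

Lemma shear_row_homog w j : shear_row w 0 j \is d.-homog.
Proof.
rewrite mxE; apply: dhomogD; first exact: hg.
by rewrite dhomogN; apply: dhomogZ; apply: hg.
Qed.

Lemma shear_row_congr w i : w 0 = 1 -> ideal_row (shear_row w) (g i - w i *: g 0).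
Proof.
move=> w0; case: (unliftP 0 i) => [j ->|->].
  by have := ideal_row_gen (shear_row w) j; rewrite mxE.
by rewrite w0 scale1r subrr; exact: (ideal_row_ideal _).1.
Qed.

Lemma shear_row_split w p : w 0 = 1 -> ideal_gen g p ->
  exists c, ideal_row (shear_row w) (p - c * g 0).
Proof.
move=> w0 [a ->]; exists (\sum_i w i *: a i); rewrite mulr_suml -sumrB.
apply: ideal_sum => [|i _]; first exact: ideal_row_ideal.
rewrite (_ : _ - _ = a i * (g i - w i *: g 0)); last by rewrite mulrBr -scalerAl -scalerAr.
by apply: (ideal_row_ideal _).2.2; apply: shear_row_congr.
Qed.

Lemma shear_row_sub w p : w 0 = 1 -> ideal_row (shear_row w) p -> ideal_gen g p.
Proof.
move=> w0 [c /matrixP/(_ 0 0)]; rewrite !mxE mulr1n => ->.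
apply: ideal_sum => [|j _]; first exact: ideal_gen_ideal.
rewrite !mxE; apply: (ideal_gen_ideal g).2.2.
apply: ideal_sub; [exact: ideal_gen_ideal | exact: ideal_gen_gen |].
by apply: ideal_scale; [exact: ideal_gen_ideal | exact: ideal_gen_gen].
Qed.

(* The four forms satisfy a homogeneous equation [F], which is monic in
   [g 0] for a general choice of [w]; so [g 0] is nilpotent modulo the
   triple. *)
Lemma primary_triple : (forall i : 'I_3, exists N, ideal_gen g ('X_i ^+ N)) ->
  exists w, w 0 = 1 /\ forall i : 'I_3, exists N, ideal_row (shear_row w) ('X_i ^+ N).
Proof.
move=> prim; have [F [e [hF F0 Fg]]] := homog_relation hg d_gt0.
have [w [w0 Fw]] := homog_nonzero_point hK hF F0.
exists w; split=> // i; pose I := ideal_row (shear_row w).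
have idI : is_ideal I := ideal_row_ideal _.
(* Modulo the triple, [0 = F(g)] becomes [F(w) * g 0 ^+ e]. *)
have g0e : I (g 0 ^+ e).
  have := homog_meval_congr idI hF (fun i => shear_row_congr i w0).
  rewrite Fg sub0r => /(ideal_opp idI); rewrite opprK => /(ideal_scale (F.@[w])^-1 idI).
  by rewrite scalerA mulVf // scale1r.
have congrX p q k : I (p - q) -> I (p ^+ k - q ^+ k).
  by move=> pq; rewrite subrXX mulrC; apply: idI.2.2.
have [N /(shear_row_split w0)[c /(congrX _ _ e)]] := prim i; rewrite -exprM exprMn => Ic.
exists (N * e)%N; rewrite -(subrK (c ^+ e * g 0 ^+ e) ('X_i ^+ _)).
by apply: idI.2.1 => //; apply: idI.2.2.
Qed.

(* In degree [2 d - 1], [4 * 'C(d + 1, 2) > 'C(2 * d + 1, 2)]. *)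
Lemma homog_syzygy : exists c : 'I_4 -> S,
  [/\ forall i, c i \is d.-1.-homog, exists i, c i != 0 & \sum_i c i * g i = 0].
Proof.
have [s [us szs mems]] := monomials_of_degree 2 d.-1.
have [s' [us' szs' mems']] := monomials_of_degree 2 (d.-1 + d).
pose v (t : 'I_4 * 'I_(size s)) : S := 'X_[nth 0%MM s t.2] * g t.1.
have sdeg (j : 'I_(size s)) : mdeg (nth 0%MM s j) = d.-1.
  by apply/eqP; rewrite -mems mem_nth.
have [|| c [[[i0 j0] cij] rel]] := mpoly_dependent (v := v) (s := s').
- move=> t m mt; rewrite mems'; apply/eqP.
  have : v t \is (d.-1 + d).-homog.
    by apply: dhomogM => //; rewrite dhomogX; apply/eqP; apply: sdeg.
  by move/dhomogP; apply.
- rewrite szs' card_prod !card_ord szs.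
  case: (d) d_gt0 => // d' _ /=.
  rewrite -[X in (X < _)%N]bin_sub ?leq_addr // -[X in (4 * X)%N]bin_sub ?leq_addr //.
  rewrite !addKn; have bin2E n : ('C(n.+1, 2) * 2 = n.+1 * n)%N.
    by rewrite bin2 /= muln2 halfK oddM /= andNb subn0.
  by have := bin2E (d' + d'.+1).+1; have := bin2E d'.+1; rewrite !addn2; nia.
exists (fun i => \sum_j c (i, j) *: 'X_[nth 0%MM s j]); split.
- move=> i; apply: rpred_sum => j _; apply: rpredZ.
  by rewrite dhomogX; apply/eqP; apply: sdeg.
- exists i0; apply: contraNneq cij => /(congr1 (mcoeff (nth 0%MM s j0))).
  rewrite mcoeff0 raddf_sum (bigD1 j0) //= mcoeffZ mcoeffX eqxx mulr1.
  rewrite big1 => [|j jj]; first by rewrite addr0 => ->.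
  by rewrite mcoeffZ mcoeffX nth_uniq // (inj_eq val_inj) (negPf jj) mulr0.
apply: etrans rel; transitivity (\sum_i \sum_j c (i, j) *: v (i, j)).
  by apply: eq_bigr => i _; rewrite mulr_suml; apply: eq_bigr => j _; rewrite scalerAl.
by rewrite pair_bigA; apply: eq_bigr => -[].
Qed.

Lemma ideal_row_homog w p e : p \is e.-homog -> (e < d)%N -> ideal_row (shear_row w) p -> p = 0.
Proof.
move=> hp ed [c /matrixP/(_ 0 0)]; rewrite !mxE mulr1n => pE.
rewrite -(pihomog_dE hp) pE raddf_sum big1 //= => j _; rewrite [_^T j 0]mxE.
by rewrite (pihomogM_homog e (c 0 j) (shear_row_homog w j)) leqNgt ed.
Qed.

(** Rewritten in [g 0] and the triple, the syzygy of degree [d - 1] has some coefficient [C] at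
    [g 0]. If [C] were zero, the other coefficients would form a Koszul syzygy of the triple, so lie
    in its ideal; having degree below [d] they would vanish, and with them the whole syzygy. *)
Lemma conductor_form w : w 0 = 1 ->
  (forall i : 'I_3, exists N, ideal_row (shear_row w) ('X_i ^+ N)) ->
  exists C : S, [/\ C \is d.-1.-homog, C != 0 & ideal_row (shear_row w) (C * g 0)].
Proof.
move=> w0 prim; have [c [hc [i ci] rel]] := homog_syzygy.
pose h := shear_row w.
have relE : (\sum_i w i *: c i) * g 0 + \sum_j c (lift 0 j) * h 0 j = 0.
  apply: etrans rel; rewrite mulr_suml !(big_ord_recl 3) w0 scale1r -addrA -big_split /=.
  by congr (_ + _); apply: eq_bigr => j _; rewrite mxE mulrBr -scalerAl -scalerAr addrC subrK.
exists (\sum_i w i *: c i); split.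
- by apply: rpred_sum => k _; apply: rpredZ; apply: hc.
- apply: contraNneq ci => C0; move: relE; rewrite C0 mul0r add0r => syz.
  have [N prN] : exists N, forall i : 'I_3, ideal_row h ('X_i ^+ N).
    have /fin_all_exists[N prN] := prim; exists (\sum_k N k)%N => k.
    rewrite (bigD1 k) //= exprD mulrC; exact: (ideal_row_ideal _).2.2.
  pose v : 'rV[S]_3 := \row_j c (lift 0 j).
  have [|u uE] := (koszul_triple2 (koszul_exact_vars K N) (prN _) (prN _) (prN _) v).1.
    apply/rowP => k; rewrite !ord1 mxE [RHS]mxE; apply: etrans syz.
    by apply: eq_bigr => j _; rewrite mxE [_^T j 0]mxE.
  have cl j : c (lift 0 j) = 0.
    have cE : c (lift 0 j) = (u *m cross_mx h) 0 j by rewrite -uE mxE.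
    apply: (ideal_row_homog (w := w) (hc _)); first by rewrite prednK.
    have idh := ideal_row_ideal h; rewrite cE mxE.
    apply: ideal_sum => // k _; rewrite mxE; apply: idh.2.2.
    by case: (nat_of_ord k) => [|[|[|?]]]; case: (nat_of_ord j) => [|[|[|?]]];
      solve [exact: idh.1 | exact: ideal_row_gen | apply: (ideal_opp idh); exact: ideal_row_gen].
  case: (unliftP 0 i) => [j ->|->]; first by rewrite cl.
  by move: C0; rewrite big_ord_recl w0 scale1r big1 ?addr0 => [->|j _]; rewrite ?cl ?scaler0.
have idh := ideal_row_ideal h.
move/eqP: relE; rewrite addr_eq0 => /eqP ->; apply: ideal_opp => //.
by apply: ideal_sum => // j _; apply: idh.2.2; apply: ideal_row_gen.
Qed.

End GeneralTriple.

(** * The socle *)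

Section QuotientRep.
Variable K : fieldType.
Local Notation S := (S3 K).
Implicit Types (I : S -> Prop) (p q a b : S).

(* [S / I] as a space of row vectors, with the multiplication operators. *)
Definition quotient_rep I n (pi : {linear S -> 'rV[K]_n}) (M : S -> 'M[K]_n) : Prop :=
  [/\ forall p, pi p = 0 <-> I p, forall v, exists p, pi p = v
    & forall a p, pi (a * p) = pi p *m M a].

Lemma mulmx_ext m n (A B : 'M[K]_(m, n)) : (forall v : 'rV_m, v *m A = v *m B) -> A = B.
Proof. by move=> e; apply/row_matrixP => i; rewrite !rowE e. Qed.

Lemma linear_comp_mul n (pi : {linear S -> 'rV[K]_n}) a :
  linear (fun p => pi (a * p)).
Proof. by move=> c p q; rewrite mulrDr linearD -scalerAr linearZ. Qed.

Lemma quotient_rep_exists I (N : 'I_3 -> nat) : is_ideal I -> (forall i, I ('X_i ^+ N i)) ->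
  exists n pi M, @quotient_rep I n pi M.
Proof.
move=> idI IX.
have I_lin c p q : I p -> I q -> I (c *: p + q).
  by move=> Ip Iq; apply: idI.2.1 => //; apply: ideal_scale.
(* [L] bounds all the [N i], so a monomial with an exponent at least [L] is in [I], and the finitely
   many others span the quotient. *)
pose L := (\sum_i N i)%N.
pose mon (t : {ffun 'I_3 -> 'I_L}) : 'X_{1..3} := [multinom (t i : nat) | i < 3].
pose e (k : 'I_#|{ffun 'I_3 -> 'I_L}|) : S := 'X_[mon (enum_val k)].
have span_e : spans_mod I e.
  have lin c p q : (exists a : 'I_#|{ffun 'I_3 -> 'I_L}| -> K, I (p - \sum_k a k *: e k)) ->
      (exists a : 'I_#|{ffun 'I_3 -> 'I_L}| -> K, I (q - \sum_k a k *: e k)) ->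
      exists a : 'I_#|{ffun 'I_3 -> 'I_L}| -> K, I (c *: p + q - \sum_k a k *: e k).
    move=> [a Ia] [b Ib]; exists (fun k => c * a k + b k).
    have := I_lin c _ _ Ia Ib; congr I; rewrite scalerBr scaler_sumr addrACA -opprD -big_split /=.
    by congr (_ - _); apply: eq_bigr => k _; rewrite scalerDl scalerA.
  have zero : exists a : 'I_#|{ffun 'I_3 -> 'I_L}| -> K, I (0 - \sum_k a k *: e k).
    exists (fun _ => 0); rewrite big1 ?subrr; [exact: idI.1 | by move=> k _; rewrite scale0r].
  move=> p; rewrite (mpolyE p); elim: (msupp p) => [|m r IH]; first by rewrite big_nil.
  rewrite big_cons; apply: lin => // {r IH}.
  have [mL|] := boolP [forall i, m i < L]%N.
    pose t : {ffun 'I_3 -> 'I_L} := [ffun i => Ordinal (forallP mL i)].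
    exists (fun k => (k == enum_rank t)%:R).
    rewrite (bigD1 (enum_rank t)) //= eqxx scale1r big1 => [|k /negPf->]; last by rewrite scale0r.
    rewrite /e enum_rankK addr0 (_ : mon t = m) ?subrr; first exact: idI.1.
    by apply/mnmP => i; rewrite mnmE ffunE.
  rewrite negb_forall => /existsP[i]; rewrite -leqNgt => Lm.
  exists (fun _ => 0); rewrite big1 ?subr0; last by move=> k _; rewrite scale0r.
  have le : (N i <= m i)%N by apply: leq_trans Lm; rewrite /L (bigD1 i) //= leq_addr.
  rewrite mpolyXE_id (bigD1 i) //= -(subnKC le) exprD -mulrA mulrC.
  exact: idI.2.2.
have [n [pi [ker sur]]] := finite_quotient I_lin idI.1 span_e.
have exM a : exists M : 'M[K]_n, forall p, pi (a * p) = pi p *m M.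
  apply: (linear_factor sur (linear_comp_mul pi a)) => p /ker Ip.
  by apply/ker; apply: idI.2.2.
exists n, pi, (fun a => sval (boolp.cid (exM a))); split=> // a p.
by case: boolp.cid.
Qed.

Lemma quotient_rep_comm I n pi M a b : @quotient_rep I n pi M -> M a *m M b = M b *m M a.
Proof.
move=> [_ sur mul]; apply: mulmx_ext => v; have [p <-] := sur v.
by rewrite !mulmxA -!mul mulrCA.
Qed.

Lemma quotient_rep_sub I n pi M p q : @quotient_rep I n pi M -> pi p = pi q -> I (p - q).
Proof. by move=> [ker _ _] e; apply/ker; rewrite linearB /= e subrr. Qed.

End QuotientRep.

Section SocleBound.
Variables (K : fieldType) (d : nat) (h : 'rV[S3 K]_3) (g0 : S3 K).
Local Notation S := (S3 K).
Local Notation X0 := ('X_(0 : 'I_3) : S).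
Local Notation X1 := ('X_(1 : 'I_3) : S).
Local Notation X2 := ('X_(2%:R : 'I_3) : S).
Let G := ideal_row h.
Hypothesis prim : forall i : 'I_3, exists N, G ('X_i ^+ N).
Variable C : S.
Hypothesis hC : C \is d.-homog.
Hypothesis Cg0 : G (C * g0).
Variable w : 'I_3 -> K.
Hypothesis w0 : w 0 = 1.
Hypothesis Cw : C.@[w] != 0.

Let idG : is_ideal G := ideal_row_ideal h.
(** [y] and [z] are linear forms that vanish at the point [w], where [C] does not; [X0], [y], [z]
    are linear coordinates. *)
Let y := X1 - w 1 *: X0.
Let z := X2 - w 2%:R *: X0.

Let in_yz (I : S -> Prop) : is_ideal I -> I y -> I z -> forall i, I ('X_i - w i *: X0).
Proof.
move=> idI Iy Iz [[|[|[|//]]] ilt].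
- by rewrite (_ : Ordinal ilt = 0) ?w0 ?scale1r ?subrr; [exact: idI.1 | exact: val_inj].
- by rewrite (_ : Ordinal ilt = 1) //; apply: val_inj.
- by rewrite (_ : Ordinal ilt = 2%:R) //; apply: val_inj.
Qed.

Let mmap_id (F : S) : mmap (@mpolyC 3 K) (fun i => 'X_i : S) F = F.
Proof.
rewrite [RHS]mpolyE /mmap; apply: eq_bigr => m _.
by rewrite mul_mpolyC mpolyXE_id.
Qed.

Let congr_yz (I : S -> Prop) (F : S) e : is_ideal I -> I y -> I z -> F \is e.-homog ->
  I (F - F.@[w] *: X0 ^+ e).
Proof.
move=> idI Iy Iz hF.
by have := homog_meval_congr idI hF (in_yz idI Iy Iz); rewrite mmap_id.
Qed.

(** Modulo [y] and [z], [C] becomes the nonzero multiple [C(w)] of [X0 ^+ d]. In this section [d] is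
    the degree of [C]. *)
Let power_yz (I : S -> Prop) : is_ideal I -> I y -> I z -> I C -> I (X0 ^+ d).
Proof.
move=> idI Iy Iz IC.
have /(ideal_sub idI IC) := congr_yz idI Iy Iz hC; rewrite opprB addrC subrK.
by move/(ideal_scale (C.@[w])^-1 idI); rewrite scalerA mulVf // scale1r.
Qed.

Variables (n : nat) (pi : {linear S -> 'rV[K]_n}) (M : S -> 'M[K]_n).
Hypothesis rep : quotient_rep G pi M.

Let ker p : pi p = 0 <-> G p. Proof. by case: rep. Qed.
Let sur v : exists p, pi p = v. Proof. by case: rep. Qed.
Let mul a p : pi (a * p) = pi p *m M a. Proof. by case: rep. Qed.
Let comm a b : M a *m M b = M b *m M a. Proof. exact: quotient_rep_comm rep. Qed.

Let N := row_mx (M y) (M z).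
Let B := M g0.

(** Two independent vectors in this kernel would lift to two socle elements of [S / G] independent
    modulo [G], contrary to [socle_triple]. *)
Lemma socle_triple_rank : (\rank (kermx (row_mx (M X0) N)) <= 1)%N.
Proof.
rewrite leqNgt; apply/negP => rk2; set A := kermx _ in rk2.
pose i0 : 'I_(\rank A) := Ordinal (ltnW rk2); pose i1 : 'I_(\rank A) := Ordinal rk2.
pose r (i : 'I_2) : 'rV[K]_n := row (if i == 0 then i0 else i1) (row_base A).
have /fin_all_exists[u ur] (i : 'I_2) : exists p, pi p = r i by apply: sur.
have soc i t : M t = M X0 \/ M t = M y \/ M t = M z -> G (t * u i).
  move=> ht; apply/ker; rewrite mul ur.
  have : r i *m row_mx (M X0) N = 0.
    by apply/sub_kermxP; rewrite (submx_trans (row_sub _ _)) // eq_row_base.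
  rewrite /N !mul_mx_row => /eqP; rewrite !row_mx_eq0 => /and3P[/eqP e0 /eqP e1 /eqP e2].
  by case: ht => [->|[->|->]].
have G0 i : G (X0 * u i) by apply: soc; left.
have Gy i : G (y * u i) by apply: soc; right; left.
have Gz i : G (z * u i) by apply: soc; right; right.
have GX1 i : G (X1 * u i).
  rewrite -[X1](subrK (w 1 *: X0)) mulrDl -scalerAl.
  by apply: idG.2.1 => //; apply: ideal_scale.
have GX2 i : G (X2 * u i).
  rewrite -[X2](subrK (w 2%:R *: X0)) mulrDl -scalerAl.
  by apply: idG.2.1 => //; apply: ideal_scale.
have [k prk] : exists k, forall i : 'I_3, G ('X_i ^+ k).
  have /fin_all_exists[k prk] := prim; exists (\sum_j k j)%N => j.
  by rewrite (bigD1 j) //= exprD mulrC; apply: idG.2.2.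
have conv t p : G (t * p) -> exists c : 'rV_3, c *m h^T = t *: p%:M.
  by case=> c cE; exists c; rewrite -cE scale_scalar_mx.
have xyz1 : koszul_exact X0 X1 X2 by have := koszul_exact_vars K 1; rewrite !expr1.
have [c [[i ci] [p pE]]] := socle_triple (koszul_exact_vars K k) (prk _) (prk _) (prk _) xyz1
  (fun p => (in_maxP p).1) (fun i => conv _ _ (G0 i)) (fun i => conv _ _ (GX1 i))
  (fun i => conv _ _ (GX2 i)).
have : pi (c 0 *: u 0 + c 1 *: u 1) = 0.
  apply/ker; exists p; rewrite -pE big_ord2 !scale_scalar_mx -raddfD /=.
  by rewrite !mul_mpolyC.
rewrite linearD !linearZ /= !ur /r /= => /eqP.
rewrite !rowE !scalemxAl -mulmxDl mulmx_free_eq0 ?row_base_free // => /eqP/rowP e.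
have := e i0; have := e i1; rewrite !mxE /= => e1 e0.
have c00 : c 0 = 0 by move: e0; rewrite mulr1 mulr0 addr0.
have c10 : c 1 = 0 by move: e1; rewrite mulr1 mulr0 add0r.
case/eqP: ci; case: i => [[|[|//]] ilt].
- by rewrite -c00; congr c; apply: val_inj.
- by rewrite -c10; congr c; apply: val_inj.
Qed.

Let idker : is_ideal (fun q => (pi (g0 * q)%R <= B *m M y + B *m M z)%MS).
Proof.
split; first by rewrite mulr0 linear0 sub0mx.
split=> [p q Ip Iq|r p Ip]; first by rewrite mulrDr linearD addmx_sub.
rewrite mulrCA mul; apply: submx_trans (submxMr (M r) Ip) _.
have Br t : (B *m M t *m M r <= B *m M t)%MS.
  by rewrite -mulmxA comm mulmxA comm -mulmxA submxMl.
by rewrite addsmxMr addsmxS.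
Qed.

(** The row space of [B] is [g0 S / G]. Modulo [(y, z)] it is spanned by the [g0 * X0 ^+ i], and
    those with [i >= d] vanish because [C] kills [g0]. *)
Lemma rank_ideal_generators : (\rank B <= \rank (B *m M y + B *m M z)%MS + d)%N.
Proof.
pose P : 'M[K]_(d, n) := \matrix_(i < d) pi (g0 * X0 ^+ i).
have le : (B <= (B *m M y + B *m M z) + P)%MS.
  apply/rV_subP => v /submxP[u ->]; have [p <-] := sur u.
  rewrite -mul; rewrite (mpolyE p) mulr_sumr linear_sum.
  apply: summx_sub => m _; rewrite -scalerAr linearZ scalemx_sub //=.
  pose I q := (pi (g0 * q)%R <= B *m M y + B *m M z)%MS.
  have Bt t : (pi (g0 * t)%R <= B *m M t)%MS.
    by rewrite mulrC mul -[g0]mulr1 mul -mulmxA submxMl.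
  have Iy : I y by apply: submx_trans (Bt y) (addsmxSl _ _).
  have Iz : I z by apply: submx_trans (Bt z) (addsmxSr _ _).
  have IC : I C by rewrite /I mulrC (ker _).2 ?sub0mx.
  have hm : ('X_[m] : S) \is (mdeg m).-homog by rewrite dhomogX; apply: eqxx.
  have := congr_yz idker Iy Iz hm.
  set a := _.@[w]; rewrite mulrBr linearB -scalerAr linearZ => Im.
  rewrite -[pi _](subrK (a *: pi (g0 * X0 ^+ mdeg m))) addmx_sub //.
    by rewrite (submx_trans Im) ?addsmxSl.
  apply: scalemx_sub; have [md|dm] := ltnP (mdeg m) d.
    have <- : row (Ordinal md) P = pi (g0 * X0 ^+ mdeg m) by rewrite rowK.
    by apply: submx_trans (addsmxSr _ _); apply: row_sub.
  apply: submx_trans (addsmxSl _ _); rewrite -(subnK dm) exprD.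
  exact: (idker.2.2 _ _ (power_yz idker Iy Iz IC)).
apply: leq_trans (mxrankS le) _; apply: leq_trans (mxrank_adds_leqif _ _) _.
by rewrite leq_add2l rank_leq_row.
Qed.

Lemma iter_mul_pi k p : pi p *m iter k (mulmx (M X0)) 1%:M = pi (X0 ^+ k * p).
Proof.
elim: k p => [|k IH] p /=; first by rewrite mulmx1 expr0 mul1r.
by rewrite mulmxA -mul IH exprSr mulrA.
Qed.

(** On the annihilator of [y] and [z] in [B], [X0 ^+ d] acts as a multiple of [C], that is, as zero;
    and [X0] has there a kernel of dimension at most one, inside the socle of [S / G]. *)
Lemma rank_ideal_cap : (\rank (B :&: kermx N)%MS <= d)%N.
Proof.
set V := (B :&: kermx N)%MS; have VN : V *m N = 0 by apply/sub_kermxP; rewrite capmxSr.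
rewrite -[X in (_ <= X)%N]muln1.
apply: leq_trans (leq_mul (leqnn d) socle_triple_rank).
apply: rank_nilpotent => //.
  move=> v; rewrite /N !mul_mx_row -!mulmxA !(comm X0) !mulmxA => /eqP.
  by rewrite row_mx_eq0 => /andP[/eqP-> /eqP->]; rewrite !mul0mx row_mx0.
apply/row_matrixP => i; rewrite row_mul row0.
have /submxP[u uE] : (row i V <= B)%MS by rewrite (submx_trans (row_sub _ _)) ?capmxSl.
have [p pE] := sur u; rewrite uE -pE -mul iter_mul_pi; apply/ker.
pose I q := G (q * (g0 * p)).
have idI : is_ideal I.
  split; first by rewrite /I mul0r; exact: idG.1.
  split=> [q q' Iq Iq'|r q Iq]; first by rewrite /I mulrDl; apply: idG.2.1.
  by rewrite /I -mulrA; apply: idG.2.2.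
have : row i V *m N = 0 by rewrite -row_mul VN row0.
rewrite uE -pE -mul mul_mx_row -!mul => /eqP; rewrite row_mx_eq0 => /andP[/eqP/ker Iy /eqP/ker Iz].
by apply: (power_yz idI Iy Iz); rewrite /I mulrA mulrC; apply: idG.2.2.
Qed.

Lemma rank_socle_cover m (U : 'M[K]_(m, n)) :
  (U *m M X0 <= B)%MS -> (U *m M y <= B)%MS -> (U *m M z <= B)%MS ->
  (\rank U <= \rank B + d.*2.+1)%N.
Proof.
move=> U0 Uy Uz.
have := rank_socle_quotient (comm X0 y) (comm X0 z) (comm y z) U0 Uy Uz.
have := rank_ideal_generators; have := rank_ideal_cap; have := socle_triple_rank.
rewrite -/N; set a := \rank (B :&: _)%MS; set b := \rank (_ + _)%MS; lia.
Qed.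

Variables (J : S -> Prop) (m : nat) (piJ : {linear S -> 'rV[K]_m}) (MJ : S -> 'M[K]_m).
Hypothesis JE : forall p, J p <-> exists c, G (p - c * g0).
Hypothesis repJ : quotient_rep J piJ MJ.

(** The projection [q] from [S / G] onto [S / J] has kernel [B], so the preimage [U] of the socle
    has rank [\rank B] more than the socle; [rank_socle_cover] bounds it. *)
Lemma socle_rank_bound :
  (\rank (kermx (row_mx (MJ X0) (row_mx (MJ X1) (MJ X2)))) <= d.*2.+1)%N.
Proof.
have [kerJ surJ mulJ] := repJ.
have [q qE] : exists q : 'M[K]_(n, m), forall p, piJ p = pi p *m q.
  apply: (linear_factor sur (linearP piJ)) => p /ker Gp; apply/kerJ/JE.
  by exists 0; rewrite mul0r subr0.
have q_comm t : M t *m q = q *m MJ t.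
  by apply: mulmx_ext => v; have [p <-] := sur v; rewrite !mulmxA -mul -!qE mulJ.
have kerq_le : (kermx q <= B)%MS.
  apply/rV_subP => v /sub_kermxP; have [p <-] := sur v.
  rewrite -qE => /kerJ/JE[c Gc]; have /eqP := (ker _).2 Gc.
  by rewrite linearB subr_eq0 => /eqP ->; rewrite mulrC mul submxMl.
have le_kerq : (B <= kermx q)%MS.
  apply/sub_kermxP/mulmx_ext => v; have [p <-] := sur v.
  rewrite mulmxA -mul -qE mulmx0; apply/kerJ/JE.
  by exists p; rewrite mulrC subrr; exact: idG.1.
have fullq : row_full q.
  rewrite -sub1mx; apply/rV_subP => v _; have [p <-] := surJ v.
  by rewrite qE submxMl.
pose D := row_mx (MJ X0) (row_mx (MJ y) (MJ z)).
pose U := kermx (q *m D).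
have UM t : U *m (q *m MJ t) = 0 -> (U *m M t <= B)%MS.
  by move=> Ut; apply: submx_trans kerq_le; apply/sub_kermxP; rewrite -mulmxA q_comm.
have : U *m (q *m D) = 0 by apply/sub_kermxP.
rewrite /D !mul_mx_row => /eqP; rewrite !row_mx_eq0 => /and3P[/eqP U0 /eqP Uy /eqP Uz].
have rkU := rank_socle_cover (UM _ U0) (UM _ Uy) (UM _ Uz).
have leD : (kermx (row_mx (MJ X0) (row_mx (MJ X1) (MJ X2))) <= kermx D)%MS.
  have mulB t t' c (v : 'rV_m) : v *m MJ t = 0 -> v *m MJ t' = 0 -> v *m MJ (t - c *: t') = 0.
    have [p <-] := surJ v; rewrite -!mulJ => e e'.
    by rewrite mulrBl -scalerAl linearB linearZ /= e e' scaler0 subrr.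
  apply/rV_subP => v /sub_kermxP; rewrite !mul_mx_row => /eqP.
  rewrite !row_mx_eq0 => /and3P[/eqP e0 /eqP e1 /eqP e2].
  by apply/sub_kermxP; rewrite !mul_mx_row e0 !mulB ?row_mx0.
apply: leq_trans (mxrankS leD) _.
move: rkU (mxrankS le_kerq) (rank_leq_row D) (rank_leq_row q).
rewrite /U !mxrank_ker (eqmxMfull D fullq) (eqP fullq).
move: (\rank B) (\rank D); lia.
Qed.

End SocleBound.

(** * Betti numbers *)

Section Betti.
Variables (K : fieldType) (J : S3 K -> Prop) (n : nat).
Variables (pi : {linear S3 K -> 'rV[K]_n}) (M : S3 K -> 'M[K]_n).
Local Notation S := (S3 K).
Local Notation X0 := ('X_(0 : 'I_3) : S).
Local Notation X1 := ('X_(1 : 'I_3) : S).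
Local Notation X2 := ('X_(2%:R : 'I_3) : S).
Hypothesis rep : quotient_rep J pi M.

Let ker p : pi p = 0 <-> J p. Proof. by case: rep. Qed.
Let sur v : exists p, pi p = v. Proof. by case: rep. Qed.
Let mul a p : pi (a * p) = pi p *m M a. Proof. by case: rep. Qed.
Let comm a b : M a *m M b = M b *m M a. Proof. exact: quotient_rep_comm rep. Qed.

(** The Koszul differentials of the variables on [S / J], acting on rows; the kernel of [D3] is the
    socle. *)
Let D3 := row_mx (M X0) (row_mx (M X1) (M X2)).
Let D2 := col_mx (row_mx 0 (row_mx (M X2) (- M X1)))
  (col_mx (row_mx (- M X2) (row_mx 0 (M X0))) (row_mx (M X1) (row_mx (- M X0) 0))).
Let D1 := col_mx (M X0) (col_mx (M X1) (M X2)).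

Let xyz : koszul_exact X0 X1 X2.
Proof. by have := koszul_exact_vars K 1; rewrite !expr1. Qed.

Lemma in_max_row k (v : 'rV[S]_k) : (forall l, in_max (v 0 l)) ->
  exists a b c, v = X0 *: a + X1 *: b + X2 *: c.
Proof.
move=> vm; have /fin_all_exists[a /fin_all_exists[b /fin_all_exists[c e]]] l :
    exists a b c, v 0 l = X0 * a + X1 * b + X2 * c by apply/in_maxP.
by exists (\row_l a l), (\row_l b l), (\row_l c l); apply/rowP => l; rewrite !mxE.
Qed.

Lemma in_max_constant k (c : 'rV[K]_k) (a1 a2 a3 : 'rV[S]_k) :
  (forall l, in_max ((\sum_i (c 0 i)%:MP *: delta_mx 0 i
    - (X0 *: a1 + X1 *: a2 + X2 *: a3)) 0 l)) ->
  c = 0.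
Proof.
move=> cm; apply/rowP => l; move: (cm l); rewrite /in_max mxE [X in _ + X]mxE mcoeffB.
have -> : (X0 *: a1 + X1 *: a2 + X2 *: a3) 0 l = X0 * a1 0 l + X1 * a2 0 l + X2 * a3 0 l.
  by rewrite !mxE.
have -> : mcoeff 0%MM (X0 * a1 0 l + X1 * a2 0 l + X2 * a3 0 l) = 0.
  by apply/in_maxP; exists (a1 0 l), (a2 0 l), (a3 0 l).
rewrite subr0 summxE (bigD1 l) //= !mxE !eqxx mulr1 big1 => [|j jl].
  by rewrite addr0 mcoeffC eqxx mulr1.
by rewrite !mxE eqxx /= eq_sym (negPf jl) mulr0.
Qed.

Variables (b0 b1 b2 : nat).
Hypothesis res : min_graded_res_2 J b0 b1 b2.

(** By minimality each basis vector of [F_2] maps into [m F_1], so the zigzag carries it to a socle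
    element. A constant combination that dies in [S / J] comes back to [m F_2] plus the kernel of
    [phi2], again in [m F_2], so it is zero. *)
Lemma betti2_le_socle : (b2 <= \rank (kermx D3))%N.
Proof.
have [a0 [a1 [a2 [phi0 [phi1 [phi2 [_ [_ [_ [J0 [ker0 [ker1 [_ [min1 min2]]]]]]]]]]]]]] := res.
have /fin_all_exists[u relu] (k : 'I_b2) :
    exists u, koszul_rel X0 X1 X2 phi0 phi1 phi2 u (delta_mx 0 k).
  have [|c1 [c2 [c3 e]]] := @in_max_row _ (delta_mx 0 k *m phi2).
    by apply: min1; apply/ker1; exists (delta_mx 0 k).
  exact: (koszul_rel_of_bottom xyz ker0 ker1 e).
pose F : 'M[K]_(b2, n) := \matrix_k pi (u k 0 0).
have Fk k t : (exists p, p *m phi0 = t *: u k) -> row k F *m M t = 0.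
  move=> [p pE]; rewrite rowK -mul; apply/ker/J0; exists p.
  by rewrite pE mxE.
have FD : (F <= kermx D3)%MS.
  apply/row_subP => k; apply/sub_kermxP.
  have [p1 [p2 [p3 [_ e1 e2 e3]]]] := relu k.
  by rewrite !mul_mx_row !Fk ?row_mx0 //; [exists p3 | exists p2 | exists p1].
have indep (c : 'rV_b2) : (c *m F <= (0 : 'M[K]_(1, n)))%MS -> c = 0.
  move/submx0null => cF.
  have rl : koszul_rel X0 X1 X2 phi0 phi1 phi2
      (\sum_k (c 0 k)%:MP *: u k) (\sum_k (c 0 k)%:MP *: delta_mx 0 k).
    elim/big_rec2: _ => [|k v l _ IH]; last exact: koszul_rel_lin.
    exists 0, 0, 0; split; rewrite ?mul0mx ?scaler0 //.
    by exists 0, 0, 0; split; rewrite ?mul0mx ?scaler0 ?addr0 ?subrr.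
  have [|e1 [e2 [e3 e]]] := koszul_rel_bottom ker0 ker1 rl.
    have : J ((\sum_k (c 0 k)%:MP *: u k) 0 0).
      apply/ker; rewrite -cF mulmx_sum_row summxE linear_sum; apply: eq_bigr => k _.
      by rewrite rowK mxE mul_mpolyC linearZ.
    move/J0 => [p pE]; exists p.
    by apply/rowP => j; rewrite !ord1.
  by apply: (in_max_constant (a1 := e1) (a2 := e2) (a3 := e3)); exact: min2.
have := rank_le_of_indep FD (sub0mx _ _) indep.
by rewrite mxrank0 addn0.
Qed.

Hypothesis J_max : forall p, J p -> in_max p.
Variable g : 'I_4 -> S.
Hypothesis Jg : forall p, J p <-> ideal_gen g p.

(** The image of [D1] is [m / J], which misses the class of 1. *)
Lemma rank_D1 : (\rank D1 < n)%N.
Proof.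
rewrite ltnNge; apply/negP => le; have full : row_full D1.
  by rewrite /row_full eqn_leq rank_leq_col.
have /submxP[v] : (pi 1 <= D1)%MS by apply: submx_full.
rewrite -[v]hsubmxK -[rsubmx v]hsubmxK; have [p <-] := sur (lsubmx v).
have [q <-] := sur (lsubmx (rsubmx v)); have [r <-] := sur (rsubmx (rsubmx v)).
rewrite /D1 !mul_row_col -!mul -!(linearD pi) => /(quotient_rep_sub rep)/J_max.
have : in_max (X0 * p + (X1 * q + X2 * r)) by apply/in_maxP; exists p, q, r; rewrite addrA.
rewrite /in_max mcoeffB mcoeff1 eqxx => ->; rewrite subr0 => /eqP.
by rewrite oner_eq0.
Qed.

(** Writing each [g i] through the variables gives four cycles. A cycle modulo [J] is a relation
    with right-hand side in [J]; splitting its coefficients [f i] into constant and non-constant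
    parts reduces it, up to these four cycles, to a Koszul cycle over [S], which is a boundary. *)
Lemma koszul_cycles : exists W : 'M[K]_(4, n + (n + n)), (kermx D1 <= D2 + W)%MS.
Proof.
have /fin_all_exists[a /fin_all_exists[b /fin_all_exists[c gE]]] i :
    exists a b c, g i = X0 * a + X1 * b + X2 * c.
  by apply/in_maxP/J_max/Jg; apply: ideal_gen_gen.
pose E (e : 'I_4 -> S) : 'M[K]_(4, n) := \matrix_i pi (e i).
exists (row_mx (E a) (row_mx (E b) (E c))).
apply/rV_subP => v /sub_kermxP.
rewrite -[v]hsubmxK -[rsubmx v]hsubmxK; have [p <-] := sur (lsubmx v).
have [q <-] := sur (lsubmx (rsubmx v)); have [r <-] := sur (rsubmx (rsubmx v)).
rewrite /D1 !mul_row_col -!mul -!(linearD pi) => /ker/Jg[f fE].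
pose f0 i := mcoeff 0%MM (f i).
have /fin_all_exists[f1 /fin_all_exists[f2 /fin_all_exists[f3 f123]]] i :
    exists f1 f2 f3, f i - (f0 i)%:MP = X0 * f1 + X1 * f2 + X2 * f3.
  by apply/in_maxP; apply: mpoly_split_const.
pose P := p - \sum_i (f0 i *: a i + f1 i * g i).
pose Q := q - \sum_i (f0 i *: b i + f2 i * g i).
pose R := r - \sum_i (f0 i *: c i + f3 i * g i).
have : X0 * P + X1 * Q + X2 * R = 0.
  transitivity (X0 * p + (X1 * q + X2 * r) - \sum_i f i * g i); last by rewrite fE subrr.
  rewrite [\sum_i f i * g i](_ : _ = X0 * (\sum_i (f0 i *: a i + f1 i * g i))
    + X1 * (\sum_i (f0 i *: b i + f2 i * g i)) + X2 * (\sum_i (f0 i *: c i + f3 i * g i))).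
    by rewrite /P /Q /R; ring.
  rewrite !mulr_sumr -!big_split /=; apply: eq_bigr => i _.
  rewrite -[in LHS](subrK (f0 i)%:MP (f i)) f123 mulrDl {2}gE -!mul_mpolyC; ring.
have [_ _ exact3] := xyz; case/exact3 => A [B [C [PE QE RE]]].
have piE p' (F e : 'I_4 -> S) :
    pi p' = pi (p' - \sum_i (f0 i *: e i + F i * g i)) + (\row_i f0 i) *m E e.
  rewrite linearB linear_sum mulmx_sum_row.
  rewrite [X in _ - X + _](_ : _ = \sum_i (\row_i f0 i) 0 i *: row i (E e)) ?subrK //.
  apply: eq_bigr => i _; rewrite linearD linearZ mxE rowK /= (_ : pi (F i * g i) = 0) ?addr0 //.
  by apply/ker/Jg/(ideal_gen_ideal g).2.2/ideal_gen_gen.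
rewrite (piE p f1 a) (piE q f2 b) (piE r f3 c) -/P -/Q -/R -!add_row_mx -!mul_mx_row.
rewrite addmx_sub // ?(submx_trans (submxMl _ _)) ?addsmxSr //.
apply: submx_trans (addsmxSl _ _).
have -> : row_mx (pi P) (row_mx (pi Q) (pi R)) = row_mx (pi A) (row_mx (pi B) (pi C)) *m D2.
  rewrite /D2 !mul_row_col !mul_mx_row !mulmx0 !mulmxN !add_row_mx -!mul PE QE RE !linearB /=.
  congr (row_mx _ (row_mx _ _)); first by rewrite add0r addrC.
    by rewrite add0r.
  by rewrite addr0 addrC.
exact: submxMl.
Qed.

(** One zigzag step sends the basis of [F_1] to Koszul 2-cycles on [S / J], independent modulo
    boundaries by minimality. The Euler count with four extra cycles leaves the excess [4 - 1]. *)
Lemma betti1_le_socle : (b1 <= \rank (kermx D3) + 3)%N.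
Proof.
have [a0 [a1 [a2 [phi0 [phi1 [phi2 [_ [_ [_ [J0 [ker0 [ker1 [min0 [min1 _]]]]]]]]]]]]]] := res.
have phi10 : phi1 *m phi0 = 0.
  by apply/row_matrixP => i; rewrite row_mul row0; apply/ker0; exists (delta_mx 0 i); rewrite rowE.
have /fin_all_exists[q1 /fin_all_exists[q2 /fin_all_exists[q3 lift_q]]] (k : 'I_b1) :
    exists q1 q2 q3, koszul_lift X0 X1 X2 phi0 phi1 q1 q2 q3 (delta_mx 0 k).
  have [|c1 [c2 [c3 e]]] := @in_max_row _ (delta_mx 0 k *m phi1).
    by apply: min0; apply/ker0; exists (delta_mx 0 k).
  exact: (koszul_lift_total xyz phi10 e).
pose E (q : 'I_b1 -> 'rV[S]_1) : 'M[K]_(b1, n) := \matrix_k pi (q k 0 0).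
pose F := row_mx (E q1) (row_mx (E q2) (E q3)).
have cyc t t' (p p' : 'rV[S]_1) : (exists a, a *m phi0 = t *: p - t' *: p') ->
    pi (p 0 0) *m M t = pi (p' 0 0) *m M t'.
  move=> [a aE]; rewrite -!mul; apply/eqP; rewrite -subr_eq0 -linearB; apply/eqP/ker/J0.
  by exists a; rewrite aE !mxE.
have FD : (F <= kermx D2)%MS.
  apply/row_subP => k; apply/sub_kermxP; have [c1 [c2 [c3 [_ e1 e2 e3]]]] := lift_q k.
  rewrite !row_row_mx !rowK /D2 !mul_row_col !mul_mx_row !mulmx0 !mulmxN !add_row_mx.
  rewrite (cyc X1 X2 (q3 k) (q2 k)) ?(cyc X2 X0 (q1 k) (q3 k)) ?(cyc X0 X1 (q2 k) (q1 k)).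
  - by rewrite !add0r !addr0 !addNr ?subrr !row_mx0.
  - by exists c3.
  - by exists c2.
  - by exists c1.
have DD : (D3 <= kermx D2)%MS.
  apply/sub_kermxP; rewrite /D3 /D2 !mul_row_col !mul_mx_row !mulmx0 !mulmxN !add_row_mx.
  rewrite (comm X2 X1) (comm X2 X0) (comm X1 X0).
  by rewrite !add0r !addr0 !addNr ?subrr !row_mx0.
have indep (c : 'rV_b1) : (c *m F <= D3)%MS -> c = 0.
  case/submxP => v; have [u <-] := sur v.
  rewrite /F /D3 !mul_mx_row => /eq_row_mx[e1 /eq_row_mx[e2 e3]].
  have lft : koszul_lift X0 X1 X2 phi0 phi1
      (\sum_k (c 0 k)%:MP *: q1 k) (\sum_k (c 0 k)%:MP *: q2 k) (\sum_k (c 0 k)%:MP *: q3 k)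
      (\sum_k (c 0 k)%:MP *: delta_mx 0 k).
    elim: (index_enum _) => [|k r IH]; last first.
      by rewrite !big_cons; exact: (koszul_lift_lin _ (lift_q k) IH).
    rewrite !big_nil; exists 0, 0, 0.
    by split; rewrite ?mul0mx ?scaler0 ?addr0 ?subrr.
  have bd t (q : 'I_b1 -> 'rV[S]_1) : c *m E q = pi u *m M t ->
      exists r, \sum_k (c 0 k)%:MP *: q k = t *: u%:M + r *m phi0.
    move=> e; have : J ((\sum_k (c 0 k)%:MP *: q k) 0 0 - t * u).
      apply: (quotient_rep_sub rep); rewrite mul -e mulmx_sum_row summxE linear_sum.
      by apply: eq_bigr => k _; rewrite rowK mxE mul_mpolyC linearZ.
    case/J0 => r rE; exists r; apply/rowP => j; rewrite !ord1 mxE -rE.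
    by rewrite !mxE eqxx mulr1n addrC subrK.
  have [r1 f1] := bd _ _ e1; have [r2 f2] := bd _ _ e2; have [r3 f3] := bd _ _ e3.
  have [d1 [d2 [d3 e]]] := koszul_lift_boundary (fun v => (ker0 v).1) lft f1 f2 f3.
  by apply: (in_max_constant (a1 := d1) (a2 := d2) (a3 := d3)); exact: min1.
have := rank_le_of_indep FD DD indep; have [W /(rank_koszul_euler D3 rank_D1)] := koszul_cycles.
move: (\rank (kermx D2)) (\rank D3) (\rank (kermx D3)); lia.
Qed.

End Betti.

Theorem theorem3p9 (K : fieldType) (hK : infinite_type K) (d : nat)
    (g : 'I_4 -> {mpoly K[3]})
    (hg : forall i, g i \is d.-homog)
    (ht : height_eq (ideal_gen g) 3) :
  (forall n, betti_eq (ideal_gen g) 1 n -> (n <= 2 * d + 2)%N) /\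
  (forall n, betti_eq (ideal_gen g) 2 n -> (n <= 2 * d - 1)%N).
Proof.
have d_gt0 := height3_degree hg ht.
have idJ := ideal_gen_ideal g.
have J_max p : ideal_gen g p -> in_max p := ideal_gen_in_max hg d_gt0.
have primJ i := height3_power hg i ht.1.
have [w [w0 primG]] := primary_triple hK hg d_gt0 primJ.
have [C [hC C0 Cg]] := conductor_form hg d_gt0 w0 primG.
have [p [p0 Cp]] := homog_nonzero_point hK hC C0.
have [NJ prJ] := fin_all_exists primJ.
have [NG prG] := fin_all_exists primG.
have [m [piJ [MJ repJ]]] := quotient_rep_exists idJ prJ.
have [n [pi [M rep]]] := quotient_rep_exists (ideal_row_ideal _) prG.
have JE q : ideal_gen g q <-> exists c, ideal_row (shear_row g w) (q - c * g 0).
  split=> [/(shear_row_split w0)//|[c Gc]].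
  rewrite -(subrK (c * g 0) q); apply: idJ.2.1; first exact: (shear_row_sub w0 Gc).
  by apply/idJ.2.2/ideal_gen_gen.
(* [C] has degree [d - 1], so the bound is [2 * (d - 1) + 1 = 2 * d - 1]. *)
have soc := socle_rank_bound primG hC Cg p0 Cp rep JE repJ.
split=> b [b0 [b1 [b2 [res <-]]]] /=.
  have := betti1_le_socle repJ res J_max (fun q => iff_refl _).
  by move: (\rank _) soc; lia.
have := betti2_le_socle repJ res.
by move: (\rank _) soc; lia.
Qed.
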